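(* Let $m\ge 1$, let $M$ be a compact complex Hermitian manifold with metric $E_M$, let $\varphi:[0,\infty)\to(0,\infty)$ be an admissible weight, and let $f:\mathbb{C}^m\to M$ be a holomorphic mapping. Then $f\in\mathcal{Y}_{\varphi}(\mathbb{C}^m,M)$ if and only if for all sequences $\{z_j\},\{\xi_j\}\subset\mathbb{C}^m$ with $\|z_j\|\to\infty$ and $\|\xi_j\|=1$, the family $$\mathcal{F}=\{F_j(\zeta):=f(z_j+\varphi(\|z_j\|)\xi_j\zeta),\ j\in\mathbb{N}\}$$ of holomorphic mappings $\mathbb{C}\to M$ is normal on $\mathbb{C}$.
   Context: Admissible weight: a positive function $\varphi:[0,\infty)\to(0,\infty)$ such that, with $$\gamma_r:=\sup_{r\le a<b}\left|\frac{\varphi(a)-\varphi(b)}{a-b}\right|,$$ there is a constant $C\in(0,1]$ with $\gamma_r\le C$ for all $r\in(0,\infty)$, and $\lim_{r\to\infty}\gamma_r=0$. Metric: for a complex manifold $M$ with Hermitian metric $ds_M^2=\sum_{i,j}h_{ij}(p)\,dz_i\,d\bar z_j$ in local coordinates, $E_M(p,\xi)=(ds_M^2(\xi,\bar\xi))^{1/2}$ is the length of the tangent vector $\xi\in T_p(M)$ at $p$. $\|\cdot\|$ is the Euclidean norm on $\mathbb{C}^m$. Weighted Yosida mappings: a holomorphic mapping $f:\mathbb{C}^m\to M$ belongs to $\mathcal{Y}_{\varphi}(\mathbb{C}^m,M)$ if $$\limsup_{\|z\|\to\infty,\ \|\xi\|=1}\varphi(\|z\|)\,E_M(f(z),df(z)(\xi))<\infty,$$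 where $df(z):T_z(\mathbb{C}^m)\to T_{f(z)}(M)$ is the differential of $f$ and $\xi$ ranges over unit vectors of $\mathbb{C}^m$. Normality: for a domain $D$, a family $\mathcal{F}$ of holomorphic mappings $D\to M$ is normal on $D$ if every sequence in $\mathcal{F}$ has a subsequence which is relatively compact in the space $\mathcal{H}(D,M)$ of holomorphic mappings $D\to M$ (with the topology of uniform convergence on compact subsets). *)

(* Defs.v *)
From HB Require Import structures.
From mathcomp Require Import all_boot all_order all_algebra.
From mathcomp Require Import complex.
From mathcomp Require Import all_classical all_reals all_analysis.

Set Implicit Arguments.
Unset Strict Implicit.
Unset Printing Implicit Defensive.

Import Order.TTheory GRing.Theory Num.Theory.
Import numFieldNormedType.Exports.

Local Open Scope classical_set_scope.
Local Open Scope ring_scope.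
Local Open Scope complex_scope.

(* As the library does for realType: R[i] with the topology of its norm. *)
HB.instance Definition _ (R : realType) := PseudoPointedMetric.copy R[i] R[i]^o.
HB.instance Definition _ (R : realType) := GRing.ComAlgebra.copy R[i] R[i]^o.
HB.instance Definition _ (R : realType) := Vector.copy R[i] R[i]^o.
HB.instance Definition _ (R : realType) := NormedModule.copy R[i] R[i]^o.

(* C^n is 'rV[R[i]]_n.  Its library norm is the sup norm, which gives the usual
   topology and notion of differentiability; the Euclidean norm is [enorm].
   [differentiable] over the scalar field R[i] is complex differentiability. *)
Definition enorm (R : realType) (m : nat) (z : 'rV[R[i]]_m) : R :=
  Num.sqrt (\sum_(k < m) (complex.Re (z ord0 k) ^+ 2 + complex.Im (z ord0 k) ^+ 2)).

(* Valued in \bar R, so that an infinite supremum is not read as 0.  It is used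
   for r > 0 only, so only the values of phi on [0, +oo[ matter. *)
Definition weight_gamma (R : realType) (phi : R -> R) (r : R) : \bar R :=
  ereal_sup [set (`|(phi ab.1 - phi ab.2) / (ab.1 - ab.2)|)%:E |
             ab in [set ab : R * R | r <= ab.1 /\ ab.1 < ab.2]].

Record admissible_weight (R : realType) (phi : R -> R) : Prop := {
  weight_gt0 : forall x, 0 <= x -> 0 < phi x;
  weight_bound : exists c : R, [/\ 0 < c, c <= 1 &
    forall r, 0 < r -> (weight_gamma phi r <= c%:E)%E];
  weight_lim : weight_gamma phi r @[r --> +oo] --> 0%E }.

(* Complex manifolds of dimension n: an atlas on the topological space M.
   [chart_map i] is meaningful on [chart_dom i] only, and [chart_inv i], its inverse,
   on the open image [chart_map i @` chart_dom i] only. *)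
Record complex_atlas (R : realType) (n : nat) (M : topologicalType) := {
  chart_index : Type;
  chart_dom : chart_index -> set M;
  chart_map : chart_index -> M -> 'rV[R[i]]_n;
  chart_inv : chart_index -> 'rV[R[i]]_n -> M;
  chart_dom_open : forall i, open (chart_dom i);
  chart_cover : forall p, exists i, chart_dom i p;
  chart_map_open : forall i, open (chart_map i @` chart_dom i);
  chart_mapK : forall i p, chart_dom i p -> chart_inv i (chart_map i p) = p;
  chart_map_continuous : forall i p, chart_dom i p -> {for p, continuous (chart_map i)};
  chart_inv_continuous : forall i x,
    (chart_map i @` chart_dom i) x -> {for x, continuous (chart_inv i)};
  transition_holomorphic : forall i j p, chart_dom i p -> chart_dom j p ->
    differentiable (chart_map j \o chart_inv i) (chart_map i p) }.

Arguments chart_dom {R n M} c _ _.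
Arguments chart_map {R n M} c _ _.
Arguments chart_inv {R n M} c _ _.

Definition holomorphic_map (R : realType) (n : nat) (M : topologicalType)
    (X : complex_atlas R n M) (V : normedModType R[i]) (f : V -> M) : Prop :=
  continuous f /\
  forall z i, chart_dom X i (f z) -> differentiable (chart_map X i \o f) z.

(* C^k in the real sense on an open set: all real directional derivatives
   exist and are C^(k-1). *)
Fixpoint Ck_on (R : realType) (n : nat) (k : nat) (U : set 'rV[R[i]]_n)
    (g : 'rV[R[i]]_n -> R) : Prop :=
  (forall x, U x -> {for x, continuous g}) /\
  if k is k'.+1 then
    forall v : 'rV[R[i]]_n,
      (forall x, U x -> derivable (fun t : R => g (x + t%:C *: v)) 0 1) /\
      Ck_on k' U (fun x => 'D_1 (fun t : R => g (x + t%:C *: v)) 0)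
  else True.

Definition smooth_on (R : realType) (n : nat) (U : set 'rV[R[i]]_n)
    (g : 'rV[R[i]]_n -> R[i]) : Prop :=
  forall k, Ck_on k U (fun x => complex.Re (g x)) /\
            Ck_on k U (fun x => complex.Im (g x)).

Definition hform (R : realType) (n : nat) (h : 'M[R[i]]_n) (v : 'rV[R[i]]_n) :
    R[i] :=
  \sum_(a < n) \sum_(b < n) h a b * v ord0 a * (v ord0 b)^*.

(* [hmx i p] is the matrix (h_ab(p)) in the coordinates of chart i.  In
   [hmx_gt0] the order is that of R[i]: 0 < z means that z is real and
   positive.  [hmx_compat] says that the local expressions agree on overlaps. *)
Record hermitian_metric (R : realType) (n : nat) (M : topologicalType)
    (X : complex_atlas R n M) := {
  hmx : chart_index X -> M -> 'M[R[i]]_n;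
  hmx_herm : forall i p a b, chart_dom X i p -> hmx i p b a = (hmx i p a b)^*;
  hmx_gt0 : forall i p v, chart_dom X i p -> v != 0 -> 0 < hform (hmx i p) v;
  hmx_smooth : forall i a b,
    smooth_on (chart_map X i @` chart_dom X i) (fun x => hmx i (chart_inv X i x) a b);
  hmx_compat : forall i j p v, chart_dom X i p -> chart_dom X j p ->
    hform (hmx j p) ('d (chart_map X j \o chart_inv X i) (chart_map X i p) v) =
    hform (hmx i p) v }.

Arguments hmx {R n M X} h _ _.

(* T_p(M) is C^n, a tangent vector at p being given by its components in the
   chart [chart_at X p] chosen at p.  [tangent_norm_differential] shows that
   the choice is immaterial. *)
Definition chart_at (R : realType) (n : nat) (M : topologicalType)
    (X : complex_atlas R n M) (p : M) : chart_index X :=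
  projT1 (cid (chart_cover X p)).

Definition tangent (R : realType) (n : nat) (M : topologicalType)
    (X : complex_atlas R n M) (p : M) : Type := 'rV[R[i]]_n.

Definition tangent_norm (R : realType) (n : nat) (M : topologicalType)
    (X : complex_atlas R n M) (H : hermitian_metric X) (p : M)
    (v : tangent X p) : R :=
  Num.sqrt (complex.Re (hform (hmx H (chart_at X p) p) v)).

Definition differential (R : realType) (n : nat) (M : topologicalType)
    (X : complex_atlas R n M) (V : normedModType R[i]) (f : V -> M) (z xi : V) :
    tangent X (f z) :=
  'd (chart_map X (chart_at X (f z)) \o f) z xi.

Lemma chart_atP (R : realType) (n : nat) (M : topologicalType)
  (X : complex_atlas R n M) (p : M) : chart_dom X (chart_at X p) p.
Proof. exact: projT2 (cid (chart_cover X p)). Qed.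

Lemma diff_chart_change (R : realType) (n : nat) (M : topologicalType)
    (X : complex_atlas R n M) (V : normedModType R[i]) (f : V -> M) (z xi : V)
    (i j : chart_index X) :
  holomorphic_map X f -> chart_dom X i (f z) -> chart_dom X j (f z) ->
  'd (chart_map X j \o chart_inv X i) (chart_map X i (f z))
     ('d (chart_map X i \o f) z xi) = 'd (chart_map X j \o f) z xi.
Proof.
move=> [fc fd] iz jz.
have di := fd z i iz; have dj := fd z j jz.
have dt := transition_holomorphic iz jz.
have E := congr1 (fun h : V -> 'rV[R[i]]_n => h xi) (diff_comp di dt).
apply: (etrans (esym E)).
apply: (etrans (esym (deriveE xi (differentiable_comp di dt)))).
apply: (etrans _ (deriveE xi dj)).
apply: near_eq_derive; near=> y; rewrite /= chart_mapK //.
near: y; apply: fc; apply: open_nbhs_nbhs.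
by split=> //; exact: chart_dom_open.
Unshelve. all: by end_near. Qed.

Lemma tangent_norm_differential (R : realType) (n : nat) (M : topologicalType)
    (X : complex_atlas R n M) (H : hermitian_metric X) (V : normedModType R[i])
    (f : V -> M) (z xi : V) (i : chart_index X) :
  holomorphic_map X f -> chart_dom X i (f z) ->
  tangent_norm H (differential X f z xi) =
  Num.sqrt (complex.Re (hform (hmx H i (f z)) ('d (chart_map X i \o f) z xi))).
Proof.
move=> hf iz; have jz := chart_atP X (f z).
have E := hmx_compat H (differential X f z xi) jz iz.
have D := diff_chart_change xi hf jz iz.
apply: (congr1 (fun c => Num.sqrt (complex.Re c))).
exact: etrans (esym E) (congr1 (hform (hmx H i (f z))) D).
Qed.

(* The filter "||z|| -> oo, ||xi|| = 1" on pairs (z, xi). *)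
Definition yosida_filter (R : realType) (m : nat) :
    set_system ('rV[R[i]]_m * 'rV[R[i]]_m) :=
  filter_from [set: R]
    (fun r => [set zxi | r < enorm zxi.1 /\ enorm zxi.2 = 1]).

Definition weighted_yosida (R : realType) (n : nat) (M : topologicalType)
    (X : complex_atlas R n M) (H : hermitian_metric X) (phi : R -> R) (m : nat)
    (f : 'rV[R[i]]_m -> M) : Prop :=
  holomorphic_map X f /\
  (limf_esup (fun zxi : 'rV[R[i]]_m * 'rV[R[i]]_m =>
     (phi (enorm zxi.1) * tangent_norm H (differential X f zxi.1 zxi.2))%:E)
   (@yosida_filter R m) < +oo)%E.

(* Relative compactness in the space of holomorphic mappings V -> M, as a
   subspace of {family compact, V -> M} (uniform convergence on compact sets):
   the closure of A in that subspace is [closure A `&` holomorphic_map X].  A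
   compact Hausdorff space M carries only one uniform structure inducing its
   topology, so it need not be tied to a metric. *)
Definition relatively_compact_holomorphic (R : realType) (n : nat)
    (M : puniformType) (X : complex_atlas R n M) (V : normedModType R[i])
    (A : set (V -> M)) : Prop :=
  compact (closure (A : set {family compact, V -> M}) `&`
           [set g | holomorphic_map X g]).

Definition normal_family (R : realType) (n : nat)
    (M : puniformType) (X : complex_atlas R n M) (V : normedModType R[i])
    (F : set (V -> M)) : Prop :=
  F `<=` [set g | holomorphic_map X g] /\
  forall u : nat -> V -> M, (forall k, F (u k)) ->
    exists2 s : nat -> nat, {homo s : i j / (i < j)%N} &
      relatively_compact_holomorphic X (range (u \o s)).

(* Main.v *)
(* Forward direction: [phi] varies slowly, so the Yosida bound controls the speed
   of all but finitely many [F_j] on any fixed disc of C.  A map of bounded speed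
   cannot leave a small chart ball quickly, so compactness of [M] makes the family
   equicontinuous; by Ascoli it is precompact, and by Weierstrass' theorem in
   charts its limits are holomorphic.
   Backward direction: if the Yosida quantity is unbounded along [(z_j, xi_j)], it
   is the speed of [F_j] at 0.  Near a cluster point of the [F_j], infinitely many
   of them map a fixed disc into a fixed chart ball, and Cauchy's estimate bounds
   their speed at 0.
   Both directions rest on Cauchy's estimate for functions that are merely complex
   differentiable at each point.  It is obtained without integrals: circulations
   are trapezoid sums on [2^k x 2^k] grids, Goursat's bisection argument shows
   that they vanish as [k] grows, and [Im] of the circulation of [1/z] is at
   least 8. *)
Require Import Defs.
From HB Require Import structures.
From mathcomp Require Import all_boot all_order all_algebra.
From mathcomp Require Import complex.
From mathcomp Require Import all_classical all_reals all_analysis.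
From mathcomp Require Import ring lra zify.

Set Implicit Arguments.
Unset Strict Implicit.
Unset Printing Implicit Defensive.

Import Order.TTheory GRing.Theory Num.Theory.
Import numFieldNormedType.Exports.

Local Open Scope classical_set_scope.
Local Open Scope ring_scope.
Import Normc.

Local Open Scope complex_scope.


(** * Bisection *)

(** No integral is ever formed: each statement on circulations says that a finite sum is small for
    all large [k]. Trapezoid sums have the two properties that Goursat's argument uses: inner edges
    cancel exactly, and affine functions have circulation exactly zero, so the tangent map can be
    subtracted at each point. The rule is doubled to avoid halves, so the true circulation of
    [1 / z] would be [4 * pi * i]; the crude bound 8 is enough, since Cauchy's estimate only needs
    to divide by a positive constant. The uniform structure of [M] is abstract and the Hermitian
    metric gives lengths of vectors only. The two meet in charts, where the Hermitian form is
    pinched between multiples of the squared size of the coordinates. Slow variation of [phi] acts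
    twice: it gives [phi s * rho <= s / 2] for large [s], which keeps the rescaled discs in the
    region where the Yosida bound holds, and it makes the weights at two points of such a disc
    comparable. *)

Definition in_square (R : realType) (x y l u v : R) :=
  (x <= u <= x + l) && (y <= v <= y + l).

(** The supremum of the left endpoints works: by nesting, each left endpoint lies below every right
    endpoint. *)
Lemma nested_itv_point (R : realType) (a l : nat -> R) :
  (forall n, 0 <= l n) ->
  (forall n, a n <= a n.+1 /\ a n.+1 + l n.+1 <= a n + l n) ->
  exists u, forall n, a n <= u <= a n + l n.
Proof.
move=> l0 H.
have mono n k : a n <= a (n + k)%N /\ a (n + k)%N + l (n + k)%N <= a n + l n.
  elim: k => [|k [IH1 IH2]]; first by rewrite addn0.
  rewrite addnS; have [H1 H2] := H (n + k)%N.
  by split; [exact: le_trans IH1 H1|exact: le_trans H2 IH2].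
have ub n m : a m <= a n + l n.
  have [/subnKC <-|/ltnW/subnKC <-] := leqP n m.
    have [_] := mono n (m - n)%N; apply: le_trans; by rewrite lerDl.
  have [h _] := mono m (n - m)%N; apply: le_trans h _; by rewrite lerDl.
have hs : has_sup (range a).
  by split; [exists (a 0%N), 0%N|exists (a 0%N + l 0%N) => _ [m _ <-]].
exists (sup (range a)) => n; apply/andP; split.
  by apply: sup_upper_bound => //; exists n.
by apply: ge_sup; [exists (a 0%N), 0%N|move=> _ [m _ <-]].
Qed.

(* The local hypothesis is only needed for squares containing the point, so [d]
   need not be uniform and a covering argument would not suffice. *)
Lemma square_bisection (R : realType) (P : R -> R -> R -> Prop) (x0 y0 l0 : R) :
  0 < l0 ->
  (forall x y l, 0 < l -> P x y l -> P (x + l) y l -> P x (y + l) l ->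
     P (x + l) (y + l) l -> P x y (l * 2)) ->
  (forall u v, in_square x0 y0 l0 u v -> exists2 d, 0 < d &
     forall x y l, 0 < l < d -> in_square x y l u v ->
       x0 <= x -> x + l <= x0 + l0 -> y0 <= y -> y + l <= y0 + l0 -> P x y l) ->
  P x0 y0 l0.
Proof.
move=> l0_gt0 split4 loc; apply: contrapT => nP.
(* The assumptions on [q] stand under the existential, so [choice] yields a selection defined on all
   triples, which can be iterated. *)
have step (q : R * R * R) : exists q' : R * R * R,
    0 < q.2 -> ~ P q.1.1 q.1.2 q.2 ->
    [/\ ~ P q'.1.1 q'.1.2 q'.2, q'.2 = q.2 / 2,
     q.1.1 <= q'.1.1 /\ q'.1.1 + q'.2 <= q.1.1 + q.2 &
     q.1.2 <= q'.1.2 /\ q'.1.2 + q'.2 <= q.1.2 + q.2].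
  case: q => [[x y] l] /=.
  have [l_gt0|/negP nl] := boolP (0 < l); last by exists (x, y, l).
  have hl : 0 < l / 2 by lra.
  apply: contrapT => /forallNP nq.
  have [Pl|nPl] := pselect (P x y l); first by apply: (nq (x, y, l)).
  have all x' y' : x <= x' -> x' + l / 2 <= x + l -> y <= y' ->
      y' + l / 2 <= y + l -> P x' y' (l / 2).
    move=> h1 h2 h3 h4; apply: contrapT => nP'.
    by apply: (nq (x', y', l / 2)) => _ _; split.
  apply: nPl; have -> : l = l / 2 * 2 by lra.
  by apply: split4; rewrite //; apply: all; lra.
have [s Hs] := choice step.
pose q n := iter n s (x0, y0, l0).
have Hq n : ~ P (q n).1.1 (q n).1.2 (q n).2 /\ (q n).2 = l0 / 2 ^+ n.
  elim: n => [|n [IH1 IH2]]; first by rewrite /= expr0 divr1.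
  have qn0 : 0 < (q n).2 by rewrite IH2 divr_gt0 // exprn_gt0.
  have [h1 h2 _ _] := Hs (q n) qn0 IH1.
  by split=> //; rewrite [LHS]h2 IH2 exprS invfM mulrCA mulrC mulrA.
have q0 n : 0 < (q n).2 by rewrite (Hq n).2 divr_gt0 // exprn_gt0.
have nx n := Hs (q n) (q0 n) (Hq n).1.
have [u Hu] : exists u, forall n, (q n).1.1 <= u <= (q n).1.1 + (q n).2.
  apply: (@nested_itv_point _ (fun n => (q n).1.1) (fun n => (q n).2)) => n.
    exact: ltW.
  by have [] := nx n.
have [v Hv] : exists v, forall n, (q n).1.2 <= v <= (q n).1.2 + (q n).2.
  apply: (@nested_itv_point _ (fun n => (q n).1.2) (fun n => (q n).2)) => n.
    exact: ltW.
  by have [] := nx n.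
have sub n : [/\ x0 <= (q n).1.1, (q n).1.1 + (q n).2 <= x0 + l0,
    y0 <= (q n).1.2 & (q n).1.2 + (q n).2 <= y0 + l0].
  elim: n => [|n [a1 a2 a3 a4]]; first by split.
  have [_ _ [b1 b2] [b3 b4]] := nx n; split.
  - exact: le_trans a1 b1.
  - exact: le_trans b2 a2.
  - exact: le_trans a3 b3.
  - exact: le_trans b4 a4.
have [d d0 Hd] := loc u v ltac:(by rewrite /in_square (Hu 0%N) (Hv 0%N)).
have [n Hn] : exists n, l0 / 2 ^+ n < d.
  have [n Hn] : exists n : nat, l0 / d < n%:R.
    by exists (Num.truncn (l0 / d)).+1; apply: truncnS_gt.
  exists n; rewrite ltr_pdivrMr ?exprn_gt0 // mulrC -ltr_pdivrMr //.
  apply: lt_le_trans Hn _; rewrite -natrX ler_nat; exact: ltnW (ltn_expl _ _).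
have [a1 a2 a3 a4] := sub n.
apply: (Hq n).1; apply: Hd => //; last by rewrite /in_square Hu Hv.
by rewrite q0 (Hq n).2.
Qed.

(** * Complex numbers with the real-valued modulus *)

Lemma normc_ge0 (R : realType) (z : R[i]) : 0 <= normc z.
Proof. by case: z => a b; exact: sqrtr_ge0. Qed.

Lemma norm_normc (R : realType) (z : R[i]) : `|z| = (normc z)%:C.
Proof. by case: z. Qed.

Lemma ler_normcD (R : realType) (z w : R[i]) :
  normc (z + w) <= normc z + normc w.
Proof. exact: le_normcD. Qed.

Lemma normc_opp (R : realType) (z : R[i]) : normc (- z) = normc z.
Proof. exact: normcN. Qed.

Lemma normc_sub (R : realType) (z w : R[i]) : normc (z - w) = normc (w - z).
Proof. by rewrite -normc_opp opprB. Qed.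

Lemma ler_normcB (R : realType) (z w : R[i]) :
  normc (z - w) <= normc z + normc w.
Proof. by rewrite -(normc_opp w); exact: ler_normcD. Qed.

Lemma normc_eq0 (R : realType) (z : R[i]) : (normc z == 0) = (z == 0).
Proof.
by apply/eqP/eqP => [/eq0_normc //|->]; rewrite normc0.
Qed.

Lemma normc_gt0 (R : realType) (z : R[i]) : (0 < normc z) = (z != 0).
Proof. by rewrite lt0r normc_ge0 andbT normc_eq0. Qed.

Lemma normc_real (R : realType) (x : R) : normc x%:C = `|x|.
Proof. by rewrite /= expr0n /= addr0 sqrtr_sqr. Qed.

Lemma normc_sqr (R : realType) (z : R[i]) :
  normc z ^+ 2 = complex.Re z ^+ 2 + complex.Im z ^+ 2.
Proof. by case: z => a b /=; rewrite sqr_sqrtr // addr_ge0 // sqr_ge0. Qed.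

Lemma ler_Re_normc (R : realType) (z : R[i]) : `|complex.Re z| <= normc z.
Proof.
case: z => a b /=; rewrite -sqrtr_sqr; apply: ler_wsqrtr.
by rewrite lerDl sqr_ge0.
Qed.

Lemma ler_Im_normc (R : realType) (z : R[i]) : `|complex.Im z| <= normc z.
Proof.
case: z => a b /=; rewrite -sqrtr_sqr; apply: ler_wsqrtr.
by rewrite lerDr sqr_ge0.
Qed.

Lemma ler_normc_ReIm (R : realType) (z : R[i]) :
  normc z <= `|complex.Re z| + `|complex.Im z|.
Proof.
case: z => a b /=; rewrite -[leRHS]ger0_norm ?addr_ge0 //.
rewrite -sqrtr_sqr; apply: ler_wsqrtr.
by rewrite sqrrD !real_normK ?num_real // lerD2r lerDl mulrn_wge0 // mulr_ge0.
Qed.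

Lemma ler_normc_sum (R : realType) (I : Type) (r : seq I) (F : I -> R[i]) :
  normc (\sum_(i <- r) F i) <= \sum_(i <- r) normc (F i).
Proof.
elim/big_rec2: _ => [|i y x _ h]; first by rewrite normc0.
by apply: le_trans (ler_normcD _ _) _; rewrite lerD2l.
Qed.

Lemma nbhs_complexP (R : realType) (z : R[i]) (A : set R[i]) :
  nbhs z A <-> exists2 r : R, 0 < r & forall w, normc (w - z) < r -> A w.
Proof.
split=> [/nbhs_ballP[e /= e0 eA]|[r r0 rA]].
  have ee : e = (complex.Re e)%:C by rewrite RRe_real // gtr0_real.
  rewrite ee ltcR in e0.
  exists (complex.Re e) => // w wz; apply: eA.
  by rewrite -ball_normE /= ee norm_normc ltcR normc_sub.
apply/nbhs_ballP; exists r%:C => /=; first by rewrite ltcR.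
by move=> w; rewrite -ball_normE /= norm_normc ltcR normc_sub => /rA.
Qed.

(** The derivative with the denominator multiplied out: [w = z] is allowed, and all estimates are
    between real numbers. *)
Definition cdiff_at (R : realType) (h : R[i] -> R[i]) (z d : R[i]) : Prop :=
  forall e : R, 0 < e -> exists2 r : R, 0 < r &
    forall w, normc (w - z) < r ->
      normc (h w - h z - d * (w - z)) <= e * normc (w - z).

Lemma is_derive_cdiff_at (R : realType) (h : R[i] -> R[i]) (z d : R[i]) :
  is_derive z 1 h d <-> cdiff_at h z d.
Proof.
split=> [[dh dE] e e0|hd].
  have := dh; rewrite /derivable => /cvg_ex[/= l ll].
  have lE : l = d by rewrite -dE /derive; apply/esym/cvg_lim.
  move: ll; rewrite lE => /cvgrPdist_le /(_ e%:C); rewrite ltcR => /(_ e0).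
  rewrite near_withinE => /nbhs_complexP[r r0 Hr]; exists r => // w wz.
  have [->|wz0] := eqVneq w z.
    by rewrite !subrr mulr0 subr0 normc0 mulr0.
  have wz1 : w - z != 0 by rewrite subr_eq0.
  have := Hr (w - z); rewrite subr0 => /(_ wz wz1) /=.
  rewrite norm_normc lecR; set q := _ *: _ => hq.
  have -> : h w - h z - d * (w - z) = - ((d - q) * (w - z)).
    rewrite /q /shift /= [(w - z) *: 1]mulr1 subrK.
    rewrite -[_ *: _]/(_ * _) mulrBl mulrAC mulVf // mul1r; ring.
  by rewrite normc_opp normcM ler_wpM2r // normc_ge0.
have : (fun k : R[i] => k^-1 *: ((h \o shift z) (k *: 1) - h z)) @ 0^' --> d.
  apply/cvgrPdist_le => e e0.
  have ee : e = (complex.Re e)%:C by rewrite RRe_real // gtr0_real.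
  rewrite ee ltcR in e0.
  have [r r0 Hr] := hd _ e0.
  rewrite near_withinE; apply/nbhs_complexP; exists r => // k; rewrite subr0 => kr k0.
  have := Hr (k + z); rewrite addrK => /(_ kr).
  rewrite ee norm_normc lecR /shift /= [k *: 1]mulr1 -[_ *: _]/(_ * _) => hk.
  have -> : d - k^-1 * (h (k + z) - h z) = - (h (k + z) - h z - d * k) / k.
    by field.
  rewrite normcM normc_opp normcV ler_pdivrMr ?normc_gt0 //.
by move=> /[dup] /cvg_lim dE /cvgP; split=> //; apply: dE.
Qed.

(** * Goursat's lemma and Cauchy's estimate *)

(* Twice the trapezoid rule for the integral of [g] from [u] to [v]; it is exact
   for affine [g]. *)
Definition edge (R : realType) (g : R[i] -> R[i]) (u v : R[i]) : R[i] :=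
  (g u + g v) * (v - u).

(** The boundary of a square, counterclockwise; the top and left edges are run backwards, hence the
    minus signs. *)
Definition cell (R : realType) (g : R[i] -> R[i]) (s x y : R) : R[i] :=
  edge g (x +i* y) ((x + s) +i* y) +
  edge g ((x + s) +i* y) ((x + s) +i* (y + s)) -
  edge g (x +i* (y + s)) ((x + s) +i* (y + s)) -
  edge g (x +i* y) (x +i* (y + s)).

(** As a sum over cells, linearity and subdivision are plain identities of sums; the passage to the
    outer boundary is made in [circ_boundary]. *)
Definition circ (R : realType) (g : R[i] -> R[i]) (N : nat) (s x y : R) : R[i] :=
  \sum_(0 <= i < N) \sum_(0 <= j < N) cell g s (x + i%:R * s) (y + j%:R * s).

Lemma circ_lin (R : realType) (c : R[i]) (g1 g2 : R[i] -> R[i]) N (s x y : R) :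
  circ (fun z => c * g1 z + g2 z) N s x y =
  c * circ g1 N s x y + circ g2 N s x y.
Proof.
rewrite /circ mulr_sumr -big_split; apply: eq_bigr => i _ /=.
rewrite mulr_sumr -big_split; apply: eq_bigr => j _ /=.
by rewrite /cell /edge; ring.
Qed.

(** On an affine function each edge is a difference of values of a primitive, so the sum around a
    cell is zero. *)
Lemma circ_sub_affine (R : realType) (a b c : R[i]) (g : R[i] -> R[i]) N (s x y : R) :
  circ (fun z => g z - a - b * (z - c)) N s x y = circ g N s x y.
Proof.
apply: eq_bigr => i _; apply: eq_bigr => j _.
by rewrite /cell /edge; ring.
Qed.

Lemma circ_split (R : realType) (g : R[i] -> R[i]) N (s x y : R) :
  circ g (N + N) s x y =
  circ g N s x y + circ g N s (x + N%:R * s) y +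
  (circ g N s x (y + N%:R * s) + circ g N s (x + N%:R * s) (y + N%:R * s)).
Proof.
have sp (F : nat -> R[i]) : \sum_(0 <= i < N + N) F i =
    \sum_(0 <= i < N) F i + \sum_(0 <= i < N) F (N + i)%N.
  rewrite (big_cat_nat (n := N)) ?leq_addr //=; congr (_ + _).
  by rewrite -{1}[N]add0n big_addn addnK; apply: eq_bigr => i _; rewrite addnC.
have sh z (j : nat) : z + (N + j)%:R * s = z + N%:R * s + j%:R * s.
  by rewrite natrD mulrDl addrA.
rewrite /circ sp.
under eq_bigr do rewrite sp.
under [X in _ + X = _]eq_bigr do rewrite sp.
rewrite !big_split /= addrACA; congr (_ + _ + (_ + _)); apply: eq_bigr => i _;
  by apply: eq_bigr => j _; rewrite ?sh.
Qed.

(** Inner edges occur twice with opposite signs: horizontal ones telescope in [j], vertical ones in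
    [i]. *)
Lemma circ_boundary (R : realType) (g : R[i] -> R[i]) N (s x y : R) :
  circ g N s x y =
  \sum_(0 <= i < N)
    (edge g ((x + i%:R * s) +i* y) ((x + i%:R * s + s) +i* y) -
     edge g ((x + i%:R * s) +i* (y + N%:R * s))
       ((x + i%:R * s + s) +i* (y + N%:R * s))) +
  \sum_(0 <= j < N)
    (edge g ((x + N%:R * s) +i* (y + j%:R * s))
       ((x + N%:R * s) +i* (y + j%:R * s + s)) -
     edge g (x +i* (y + j%:R * s)) (x +i* (y + j%:R * s + s))).
Proof.
have S z (i : nat) : z + i%:R * s + s = z + i.+1%:R * s by rewrite -natr1; ring.
have Z z : z + 0%:R * s = z by rewrite mul0r addr0.
pose H i j := edge g ((x + i%:R * s) +i* (y + j%:R * s))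
  ((x + i%:R * s + s) +i* (y + j%:R * s)).
pose V i j := edge g ((x + i%:R * s) +i* (y + j%:R * s))
  ((x + i%:R * s) +i* (y + j%:R * s + s)).
have cE i j : cell g s (x + i%:R * s) (y + j%:R * s) =
    - (H i j.+1 - H i j) + (V i.+1 j - V i j).
  by rewrite /cell /H /V !S; ring.
transitivity (\sum_(0 <= i < N) - (H i N - H i 0%N) +
              \sum_(0 <= j < N) (V N j - V 0%N j)).
  rewrite /circ; under eq_bigr do under eq_bigr do rewrite cE.
  under eq_bigr do rewrite big_split /= sumrN telescope_sumr //.
  rewrite big_split /=; congr (_ + _); rewrite exchange_big /=.
  by apply: eq_bigr => j _; rewrite telescope_sumr.
by congr (_ + _); apply: eq_bigr => i _; rewrite /H /V !Z ?opprB.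
Qed.

Lemma ler_normc_edge (R : realType) (g : R[i] -> R[i]) (G s : R) (u v : R[i]) :
  normc (g u) <= G -> normc (g v) <= G -> normc (v - u) <= s ->
  normc (edge g u v) <= 2 * G * s.
Proof.
move=> gu gv uv; rewrite /edge normcM.
apply: ler_pM => //; [exact: normc_ge0|exact: normc_ge0|].
by apply: le_trans (ler_normcD _ _) _; lra.
Qed.

(** The 8 is the perimeter factor 4 times the 2 of the doubled trapezoid rule. By [circ_boundary]
    only values on the outer boundary enter. *)
Lemma ler_normc_circ (R : realType) (g : R[i] -> R[i]) N (s x y G : R) :
  0 <= s ->
  (forall u v, in_square x y (N%:R * s) u v ->
     [|| u == x, u == x + N%:R * s, v == y | v == y + N%:R * s] ->
     normc (g (u +i* v)) <= G) ->
  normc (circ g N s x y) <= 8 * (N%:R * s) * G.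
Proof.
move=> s0 gG; rewrite circ_boundary.
have bnd (i : nat) : (i <= N)%N -> 0 <= i%:R * s <= N%:R * s.
  by move=> iN; rewrite mulr_ge0 // ler_wpM2r // ler_nat.
have S z (i : nat) : z + i%:R * s + s = z + i.+1%:R * s by rewrite -natr1; ring.
have nH (a b c : R) : normc (((a + s) +i* b) - (a +i* b)) <= s.
  by rewrite /= subrr expr0n /= addr0 sqrtr_sqr addrAC subrr add0r ger0_norm.
have nV (a b c : R) : normc ((a +i* (b + s)) - (a +i* b)) <= s.
  by rewrite /= subrr expr0n /= add0r sqrtr_sqr addrAC subrr add0r ger0_norm.
have B0 := bnd 0%N isT; have BN := bnd N (leqnn _).
have main (F1 F2 : nat -> R[i]) :
    (forall i, (i < N)%N -> normc (F1 i) <= 2 * G * s) ->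
    (forall i, (i < N)%N -> normc (F2 i) <= 2 * G * s) ->
    normc (\sum_(0 <= i < N) (F1 i - F2 i)) <= 4 * (N%:R * s) * G.
  move=> h1 h2; apply: le_trans (ler_normc_sum _ _) _.
  have -> : 4 * (N%:R * s) * G = \sum_(0 <= i < N) (4 * s * G).
    by rewrite sumr_const_nat subn0 -[RHS]mulr_natr; ring.
  rewrite !big_mkord; apply: ler_sum => i _; apply: le_trans (ler_normcB _ _) _.
  by have := h1 i (ltn_ord i); have := h2 i (ltn_ord i); lra.
have -> : 8 * (N%:R * s) * G = 4 * (N%:R * s) * G + 4 * (N%:R * s) * G by ring.
apply: le_trans (ler_normcD _ _) _; apply: lerD; apply: main => i iN;
  have Bi := bnd i (ltnW iN); have Bi1 := bnd i.+1 iN;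
  apply: ler_normc_edge;
  try (apply: gG; [by rewrite /in_square ?S; lra|by rewrite ?S eqxx ?orbT]);
  [exact: nH|exact: nH|exact: nV|exact: nV].
Qed.

Lemma normc_square_sub (R : realType) (x y l u v u' v' : R) :
  in_square x y l u v -> in_square x y l u' v' ->
  normc ((u +i* v) - (u' +i* v')) <= 2 * l.
Proof.
move=> h h'; apply: le_trans (ler_normc_ReIm _) _ => /=.
have -> : 2 * l = l + l by ring.
by apply: lerD; rewrite ler_norml; move: h h'; rewrite /in_square; lra.
Qed.

(** Dyadic grids fit bisection: depth [k.+1] on a square is depth [k] on each of its quarters. *)
Definition dcirc (R : realType) (g : R[i] -> R[i]) (k : nat) (x y l : R) :=
  circ g (2 ^ k) (l / 2 ^+ k) x y.

Lemma dcirc_split (R : realType) (g : R[i] -> R[i]) k (x y l : R) :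
  dcirc g k.+1 x y (l * 2) =
  dcirc g k x y l + dcirc g k (x + l) y l +
  (dcirc g k x (y + l) l + dcirc g k (x + l) (y + l) l).
Proof.
rewrite /dcirc expnS mul2n -addnn.
have -> : l * 2 / 2 ^+ k.+1 = l / 2 ^+ k :> R.
  by rewrite exprS invfM; field; rewrite expf_eq0 pnatr_eq0 andbF.
rewrite circ_split; have -> // : (2 ^ k)%:R * (l / 2 ^+ k) = l :> R.
by rewrite natrX mulrC divfK // expf_eq0 pnatr_eq0 andbF.
Qed.

Lemma ler_normc_dcirc (R : realType) (g : R[i] -> R[i]) k (x y l G : R) :
  0 <= l ->
  (forall u v, in_square x y l u v ->
     [|| u == x, u == x + l, v == y | v == y + l] ->
     normc (g (u +i* v)) <= G) ->
  normc (dcirc g k x y l) <= 8 * l * G.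
Proof.
move=> l0 gG; have E : (2 ^ k)%:R * (l / 2 ^+ k) = l :> R.
  by rewrite natrX mulrC divfK // expf_eq0 pnatr_eq0 andbF.
rewrite -{2}E; apply: ler_normc_circ; first by rewrite divr_ge0 // exprn_ge0.
by rewrite E.
Qed.

(** The tolerance is made proportional to the area, hence additive over the four quarters. On a
    small square around a point of differentiability the remainder after the tangent map is small
    relative to the side, and the perimeter supplies the second factor [l]. *)
Lemma dcirc_goursat (R : realType) (g : R[i] -> R[i]) (x0 y0 l0 e : R) :
  0 < l0 -> 0 < e ->
  (forall u v, in_square x0 y0 l0 u v -> exists d, cdiff_at g (u +i* v) d) ->
  exists K, forall k, (K <= k)%N -> normc (dcirc g k x0 y0 l0) <= e.
Proof.
move=> l0_gt0 e0 gd.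
pose e' := e / l0 ^+ 2; have e'0 : 0 < e' by rewrite divr_gt0 // exprn_gt0.
suff [K HK] : exists K, forall k, (K <= k)%N ->
    normc (dcirc g k x0 y0 l0) <= e' * l0 ^+ 2.
  by exists K => k /HK; rewrite /e' divfK // expf_eq0 gt_eqF.
apply: (@square_bisection _ (fun x y l => exists K, forall k, (K <= k)%N ->
    normc (dcirc g k x y l) <= e' * l ^+ 2)) => //.
  move=> x y l _ [K1 H1] [K2 H2] [K3 H3] [K4 H4].
  exists (K1 + K2 + K3 + K4).+1 => -[//|k] Kk; rewrite dcirc_split.
  have -> : e' * (l * 2) ^+ 2 = e' * l ^+ 2 + e' * l ^+ 2 +
    (e' * l ^+ 2 + e' * l ^+ 2) by ring.
  have tri (a b : R[i]) (p q : R) : normc a <= p -> normc b <= q ->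
      normc (a + b) <= p + q.
    by move=> ap bq; apply: le_trans (ler_normcD _ _) (lerD ap bq).
  apply: (tri); apply: tri.
  - by apply: H1; lia.
  - by apply: H2; lia.
  - by apply: H3; lia.
  - by apply: H4; lia.
move=> u v uv; have [d Hd] := gd u v uv.
(* 16 is the 8 of the perimeter bound times the 2 of the distance bound [2 * l]; the same [2 * l]
   explains the radius [r / 2] below. *)
have [r r0 Hr] := Hd (e' / 16) ltac:(by rewrite divr_gt0).
exists (r / 2) => [|x y l /andP[l_gt0 lr] xyuv _ _ _ _]; first by rewrite divr_gt0.
exists 0%N => k _.
rewrite /dcirc -(circ_sub_affine (g (u +i* v)) d (u +i* v)).
rewrite -[circ _ _ _ _ _]/(dcirc _ k x y l).
have -> : e' * l ^+ 2 = 8 * l * (e' / 16 * (2 * l)) by field.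
apply: ler_normc_dcirc; first exact: ltW.
move=> u' v' uv' _; have n := normc_square_sub uv' xyuv.
apply: le_trans (Hr _ _) _; first by apply: le_lt_trans n _; lra.
by rewrite ler_wpM2l // divr_ge0 // ltW.
Qed.

Lemma eventually_all (I : eqType) (P : I -> nat -> Prop) (s : seq I) :
  (forall i, i \in s -> exists K, forall k, (K <= k)%N -> P i k) ->
  exists K, forall k, (K <= k)%N -> forall i, i \in s -> P i k.
Proof.
elim: s => [|i s IH] H; first by exists 0%N.
have [K1 H1] := H i (mem_head _ _).
have [K2 H2] := IH (fun j js => H j ltac:(by rewrite inE js orbT)).
exists (maxn K1 K2) => k; rewrite geq_max => /andP[k1 k2] j.
by rewrite inE => /orP[/eqP ->|]; [exact: H1|exact: H2].
Qed.

(** The outer square consists of sixteen squares of side [r]. The four central ones make up the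
    inner square; the twelve others, listed in [s], avoid 0. Depths [k.+2] and [k.+1] give the same
    mesh, so the central terms cancel exactly. *)
Lemma dcirc_annulus (R : realType) (g : R[i] -> R[i]) (r e : R) :
  0 < r -> 0 < e ->
  (forall u v, in_square (- (r * 2)) (- (r * 2)) (r * 2 * 2) u v ->
     u +i* v != 0 -> exists d, cdiff_at g (u +i* v) d) ->
  exists K, forall k, (K <= k)%N ->
    normc (dcirc g k.+2 (- (r * 2)) (- (r * 2)) (r * 2 * 2) -
           dcirc g k.+1 (- r) (- r) (r * 2)) <= e.
Proof.
move=> r0 e0 gd.
pose s := [:: (- (r * 2), - (r * 2)); (- r, - (r * 2)); (0, - (r * 2));
  (r, - (r * 2)); (- (r * 2), - r); (r, - r); (- (r * 2), 0); (r, 0);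
  (- (r * 2), r); (- r, r); (0, r); (r, r)].
have [q qs|K HK] := @eventually_all _
    (fun q k => normc (dcirc g k q.1 q.2 r) <= e / 12) s.
  apply: dcirc_goursat => // [|u v uv]; first by rewrite divr_gt0.
  have : q \in s := qs; rewrite !inE.
  do ![case/orP]; move=> /eqP E; move: uv; rewrite E /in_square /= => /andP[uv1 uv2];
    (apply: gd; [by rewrite /in_square; lra|rewrite eq_complex /= negb_and]);
    apply/orP; by [left; rewrite neq_lt; apply/orP; lra|
                   right; rewrite neq_lt; apply/orP; lra].
exists K => k /HK Hk; rewrite !dcirc_split.
have -> : - (r * 2) + r * 2 = 0 by ring.
have -> : - (r * 2) + r = - r by ring.
have -> : - r + r = 0 by ring.
rewrite add0r.
pose D q := dcirc g k q.1 q.2 r.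
rewrite [X in normc X](_ : _ = \sum_(q <- s) D q); last first.
  by rewrite /s !big_cons big_nil /D /=; ring.
apply: le_trans (ler_normc_sum _ _) _.
have -> : e = \sum_(q <- s) (e / 12).
  by rewrite /s !big_cons big_nil; field.
by rewrite big_seq [leRHS]big_seq; apply: ler_sum => q /Hk.
Qed.

(* The bound [e / |z|] on the squares around 0 costs at most [16 e], whatever
   their size, while the annuli between them contribute nothing in the limit. *)
Lemma dcirc_singular (R : realType) (g : R[i] -> R[i]) (L e : R) :
  0 < L -> 0 < e ->
  (forall u v, in_square (- L) (- L) (L * 2) u v ->
     u +i* v != 0 -> exists d, cdiff_at g (u +i* v) d) ->
  (forall e, 0 < e -> exists2 r, 0 < r &
     forall z, normc z < r -> normc (g z) * normc z <= e) ->
  exists k, normc (dcirc g k (- L) (- L) (L * 2)) <= e.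
Proof.
move=> L0 e0 gd gs.
(* Allowing an arbitrary excess [eps] lets the bound [a] pass unchanged through any number of
   annuli. *)
pose A (a M : R) := forall eps, 0 < eps -> exists K, forall k, (K <= k)%N ->
  normc (dcirc g k (- M) (- M) (M * 2)) <= a + eps.
have step a M : 0 < M -> M * 2 <= L -> A a M -> A a (M * 2).
  move=> M0 ML aM eps eps0.
  have [K1 H1] := aM (eps / 2) ltac:(lra).
  have [|u v uv uv0|K2 H2] := @dcirc_annulus _ g M (eps / 2) M0.
  - by lra.
  - by apply: gd => //; move: uv; rewrite /in_square; lra.
  exists (K1 + K2).+2 => -[//|[//|k]] Kk.
  rewrite -(subrK (dcirc g k.+1 (- M) (- M) (M * 2)) (dcirc g k.+2 _ _ _)).
  apply: le_trans (ler_normcD _ _) _.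
  have h1 := H1 k.+1 ltac:(lia); have h2 := H2 k ltac:(lia); lra.
(* On the boundary of the square of half-side [M] one has [|z| >= M], so [|g z| <= e / 32 / M], and
   the perimeter bound [8 * (M * 2)] turns this into [e / 2]. *)
have [r r0 Hr] := gs (e / 32) ltac:(lra).
have [p Hp] : exists p, L / 2 ^+ p * 2 < r.
  have [n Hn] : exists n : nat, L * 2 / r < n%:R.
    by exists (Num.truncn (L * 2 / r)).+1; apply: truncnS_gt.
  exists n; rewrite mulrAC ltr_pdivrMr ?exprn_gt0 // [r * _]mulrC -ltr_pdivrMr //.
  apply: lt_le_trans Hn _; rewrite -natrX ler_nat; exact: ltnW (ltn_expl _ _).
have base : A (e / 2) (L / 2 ^+ p).
  set M := L / _ in Hp *; have M0 : 0 < M by rewrite divr_gt0 // exprn_gt0.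
  move=> eps eps0; exists 0%N => k _.
  apply: le_trans (_ : 8 * (M * 2) * (e / 32 / M) <= _); last first.
    have -> : 8 * (M * 2) * (e / 32 / M) = e / 2 by field; exact: lt0r_neq0.
    by lra.
  apply: ler_normc_dcirc => [|u v]; first by lra.
  rewrite /in_square => uv bd.
  have nl : M <= normc (u +i* v).
    have := ler_Re_normc (u +i* v); have := ler_Im_normc (u +i* v).
    rewrite /= !ler_norml => h1 h2.
    by move: bd => /or4P[] /eqP E; move: h1 h2; rewrite E; lra.
  rewrite ler_pdivlMr //; apply: le_trans (Hr (u +i* v) _).
    by rewrite ler_wpM2l // normc_ge0.
  apply: le_lt_trans Hp; apply: le_trans (ler_normc_ReIm _) _ => /=.
  have -> : M * 2 = M + M by ring.
  by apply: lerD; rewrite ler_norml; lra.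
have all q : (q <= p)%N -> A (e / 2) (L / 2 ^+ (p - q)).
  elim: q => [|q IH] qp; first by rewrite subn0.
  have -> : L / 2 ^+ (p - q.+1) = L / 2 ^+ (p - q) * 2.
    have -> : (p - q = (p - q.+1).+1)%N by lia.
    by rewrite exprS; field; rewrite expf_eq0 pnatr_eq0 andbF.
  apply: step; first by rewrite divr_gt0 // exprn_gt0.
    have -> : (p - q = (p - q.+1).+1)%N by lia.
    rewrite exprS invfM mulrA mulrAC divfK // ler_pdivrMr ?exprn_gt0 //.
    apply: ler_peMr; first exact: ltW.
    by rewrite exprn_ege1 // ler1n.
  by apply: IH; lia.
have := all p (leqnn _); rewrite subnn expr0 divr1 => /(_ (e / 2)) [|K HK].
  by lra.
by exists K; apply: le_trans (HK K _) _ => //; lra.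
Qed.

Lemma Im_sum (R : realType) (I : Type) (r : seq I) (F : I -> R[i]) :
  complex.Im (\sum_(i <- r) F i) = \sum_(i <- r) complex.Im (F i).
Proof.
elim/big_rec2: _ => [//|i y x _ <-].
by case: (F i) => a b; case: x => c d.
Qed.

Lemma ImD (R : realType) (z w : R[i]) :
  complex.Im (z + w) = complex.Im z + complex.Im w.
Proof. by case: z => a b; case: w => c d. Qed.

Lemma ImN (R : realType) (z : R[i]) : complex.Im (- z) = - complex.Im z.
Proof. by case: z => a b. Qed.

(** On each side the integrand has imaginary part [L / (t ^+ 2 + L ^+ 2) >= 1 / (2 * L)]. A doubled
    step of length [s] thus gives at least [s / L], a whole side at least 2, and each pair of
    opposite sides the 4 of [key]. *)
Lemma Im_dcirc_inv (R : realType) (L : R) k : 0 < L ->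
  8 <= complex.Im (dcirc (fun z => z^-1) k (- L) (- L) (L * 2)).
Proof.
move=> L0; rewrite /dcirc; set s := L * 2 / _; set N := (2 ^ k)%N.
have s0 : 0 < s by rewrite divr_gt0 ?exprn_gt0 // mulr_gt0.
have Ns : N%:R * s = L * 2.
  by rewrite /s natrX mulrC divfK // expf_eq0 pnatr_eq0 andbF.
rewrite circ_boundary Ns.
have -> : - L + L * 2 = L by ring.
have hE u u' v : complex.Im (edge (fun z => z^-1) (u +i* v) (u' +i* v)) =
    (u' - u) * ((- v) / (u ^+ 2 + v ^+ 2) + (- v) / (u' ^+ 2 + v ^+ 2)).
  by rewrite /edge /= subrr; ring.
have vE u v v' : complex.Im (edge (fun z => z^-1) (u +i* v) (u +i* v')) =
    (v' - v) * (u / (u ^+ 2 + v ^+ 2) + u / (u ^+ 2 + v' ^+ 2)).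
  by rewrite /edge /= subrr; ring.
have bnd (i : nat) : (i <= N)%N -> 0 <= i%:R * s <= L * 2.
  by move=> iN; rewrite -Ns mulr_ge0 ?(ltW s0) //= ler_wpM2r ?(ltW s0) // ler_nat.
have S z (i : nat) : z + i%:R * s + s = z + i.+1%:R * s by rewrite -natr1; ring.
have low t : - L <= t <= L -> (2 * L)^-1 <= L / (t ^+ 2 + L ^+ 2).
  move=> tL; have L2 : 0 < L ^+ 2 by rewrite exprn_gt0.
  have t2 : t ^+ 2 <= L ^+ 2.
    rewrite -ler_sqrt ?exprn_ge0 ?(ltW L0) //.
    by rewrite !sqrtr_sqr (gtr0_norm L0) ler_norml.
  have d0 : 0 < t ^+ 2 + L ^+ 2 by rewrite ltr_wpDl // sqr_ge0.
  rewrite ler_pdivlMr // mulrC ler_pdivrMr ?mulr_gt0 //.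
  by move: t2; rewrite !expr2; lra.
rewrite ImD !Im_sum.
have key (F : nat -> R) : (forall i, (i < N)%N -> s * (2 * L^-1) <= F i) ->
    4 <= \sum_(0 <= i < N) F i.
  move=> FH; have -> : 4 = \sum_(0 <= i < N) (s * (2 * L^-1)).
    rewrite sumr_const_nat subn0 -[RHS]mulr_natl mulrA Ns.
    by field; exact: lt0r_neq0.
  by rewrite !big_mkord; apply: ler_sum => i _; apply: FH.
have half a b : (2 * L)^-1 <= a -> (2 * L)^-1 <= b ->
    s * (2 * L^-1) <= s * (a + b) - s * (- a - b).
  move=> ha hb; have -> : s * (2 * L^-1) = s * ((2 * L)^-1 * 4).
    by field; exact: lt0r_neq0.
  have -> : s * (a + b) - s * (- a - b) = s * ((a + b) * 2) by ring.
  by rewrite ler_wpM2l ?(ltW s0) //; move: ha hb; set c := (2 * L)^-1; lra.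
have hF u : - L <= u <= L -> - L <= u + s <= L ->
    s * (2 * L^-1) <= complex.Im (edge (fun z => z^-1) (u +i* - L) ((u + s) +i* - L)
      - edge (fun z => z^-1) (u +i* L) ((u + s) +i* L)).
  move=> /low h1 /low h2; rewrite ImD ImN !hE sqrrN opprK !mulNr.
  by rewrite (_ : u + s - u = s); [exact: half|ring].
have vF v : - L <= v <= L -> - L <= v + s <= L ->
    s * (2 * L^-1) <= complex.Im (edge (fun z => z^-1) (L +i* v) (L +i* (v + s))
      - edge (fun z => z^-1) (- L +i* v) (- L +i* (v + s))).
  move=> /low h1 /low h2; rewrite ImD ImN !vE sqrrN !mulNr ![L ^+ 2 + _]addrC.
  by rewrite (_ : v + s - v = s); [exact: half|ring].
rewrite (_ : 8 = 4 + 4 :> R); last by ring.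
by apply: lerD; apply: key => i iN; [apply: hF|apply: vF]; rewrite ?S;
  have := bnd i (ltnW iN); have := bnd i.+1 iN; lra.
Qed.

Lemma cdiff_at_unique (R : realType) (h : R[i] -> R[i]) (z d d' : R[i]) :
  cdiff_at h z d -> cdiff_at h z d' -> d = d'.
Proof.
by move=> /is_derive_cdiff_at[_ <-] /is_derive_cdiff_at[_ <-].
Qed.

Lemma cdiff_at_ext (R : realType) (h k : R[i] -> R[i]) (z d : R[i]) :
  h =1 k -> cdiff_at h z d -> cdiff_at k z d.
Proof. by move=> /funext <-. Qed.

Lemma cdiff_at_shift (R : realType) (h : R[i] -> R[i]) (a z d : R[i]) :
  cdiff_at h (a + z) d -> cdiff_at (fun w => h (a + w)) z d.
Proof.
move=> hd e e0; have [r r0 Hr] := hd e e0; exists r => // w wz.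
have E : w - z = a + w - (a + z) by ring.
by rewrite E; apply: Hr; rewrite -E.
Qed.

Lemma derivable_subc (R : realType) (f g : R[i] -> R[i]) (z : R[i]) :
  derivable f z 1 -> derivable g z 1 -> derivable (fun w => f w - g w) z 1.
Proof. exact: derivableB. Qed.

Lemma derivable_invc (R : realType) (f : R[i] -> R[i]) (z : R[i]) :
  f z != 0 -> derivable f z 1 -> derivable (fun w => (f w)^-1) z 1.
Proof. by move=> f0 fd; exact: (@derivableV _ _ f z 1 f0 fd). Qed.

Lemma derivable_mulc (R : realType) (f g : R[i] -> R[i]) (z : R[i]) :
  derivable f z 1 -> derivable g z 1 -> derivable (fun w => f w * g w) z 1.
Proof. exact: derivableM. Qed.

(* With [g z = (h z - h 0 - d z) / z^2 = o(1 / |z|)], the function [(h z - h 0) / z^2]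
   is [d / z + g z] (at 0 too, where division by 0 gives 0), and [g] has
   arbitrarily small circulation. *)
Lemma cauchy_estimate0 (R : realType) (h : R[i] -> R[i]) (d : R[i]) (L B : R) :
  0 < L ->
  (forall u v, in_square (- L) (- L) (L * 2) u v ->
     (exists d', cdiff_at h (u +i* v) d') /\ normc (h (u +i* v)) <= B) ->
  cdiff_at h 0 d -> normc d * L <= 4 * B.
Proof.
move=> L0 hH hd.
pose g z := (h z - h 0 - d * z) * (z ^+ 2)^-1.
have gd u v : in_square (- L) (- L) (L * 2) u v -> u +i* v != 0 ->
    exists d', cdiff_at g (u +i* v) d'.
  move=> /hH[[d' hd'] _] z0.
  have D1 : derivable h (u +i* v) 1 by have /is_derive_cdiff_at[] := hd'.
  have D2 : derivable g (u +i* v) 1.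
    have D3 : derivable (fun z => d * z) (u +i* v) 1.
      apply: (derivable_mulc (f := fun=> d) (g := fun z => z)).
        exact: derivable_cst.
      exact: derivable_id.
    have D4 : derivable (fun z : R[i] => z ^+ 2) (u +i* v) 1.
      apply: (derivable_mulc (f := fun z => z) (g := fun z => z));
        exact: derivable_id.
    have D6 : derivable (fun z => h z - h 0 - d * z) (u +i* v) 1.
      exact: derivable_subc (derivable_subc D1 (derivable_cst _ _ _)) D3.
    apply: (derivable_mulc D6).
    by apply: (derivable_invc _ D4); rewrite expf_neq0.
  exists ('D_1 g (u +i* v)); apply/is_derive_cdiff_at; exact: DeriveDef.
have gs e : 0 < e -> exists2 r, 0 < r &
    forall z, normc z < r -> normc (g z) * normc z <= e.
  move=> e0; have [r r0 Hr] := hd e e0; exists r => // z zr.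
  have [->|z0] := eqVneq z 0; first by rewrite normc0 mulr0 ltW.
  have := Hr z; rewrite subr0 => /(_ zr) H; rewrite -normcM /g expr2 invfM.
  by rewrite mulrA divfK // normcM normcV ler_pdivrMr ?normc_gt0.
have B0 : 0 <= B.
  apply: le_trans (normc_ge0 (h (0 +i* 0))) _; apply: (hH 0 0 _).2.
  by rewrite /in_square; lra.
apply/ler_addgt0Pr => e e0.
(* With this tolerance the end result is [8 * |d| * L <= 32 * B + 8 * e]; here [32 = 8 * 2 * 2]
   comes from the perimeter bound, the side [2 * L] and [|h z - h 0| <= 2 * B]. *)
have e10 : 0 < 8 * e / L by rewrite divr_gt0 // mulr_gt0.
have [k Hk] := dcirc_singular L0 e10 gd gs.
pose q z := (h z - h 0) * (z ^+ 2)^-1.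
have qE : q = (fun z => d * z^-1 + g z).
  apply/funext => z; rewrite /q /g.
  have [->|z0] := eqVneq z 0; first by rewrite expr0n /= invr0 !mulr0 addr0.
  by field.
have qd : dcirc q k (- L) (- L) (L * 2) =
    d * dcirc (fun z => z^-1) k (- L) (- L) (L * 2) + dcirc g k (- L) (- L) (L * 2).
  by rewrite qE /dcirc circ_lin.
have n8 : 8 <= normc (dcirc (fun z : R[i] => z^-1) k (- L) (- L) (L * 2)).
  apply: le_trans (Im_dcirc_inv k L0) _.
  exact: le_trans (ler_norm _) (ler_Im_normc _).
have qB : normc (dcirc q k (- L) (- L) (L * 2)) <= 8 * (L * 2) * (2 * B / L ^+ 2).
  apply: ler_normc_dcirc => [|u v uv bd]; first by lra.
  have nl : L <= normc (u +i* v).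
    have := ler_Re_normc (u +i* v); have := ler_Im_normc (u +i* v).
    move: uv; rewrite /in_square /= !ler_norml => uv h1 h2.
    by move: bd => /or4P[] /eqP E; move: h1 h2; rewrite E; lra.
  rewrite /q normcM normcV; apply: ler_pM; rewrite ?invr_ge0 ?normc_ge0 //.
    apply: le_trans (ler_normcB _ _) _.
    have h1 := (hH u v uv).2.
    have h2 : normc (h 0) <= B by apply: (hH 0 0 _).2; rewrite /in_square; lra.
    lra.
  have L2 : 0 < L ^+ 2 by rewrite exprn_gt0.
  have nL2 : L ^+ 2 <= normc ((u +i* v) ^+ 2).
    by rewrite !expr2 normcM; apply: ler_pM; rewrite ?(ltW L0).
  by rewrite lef_pV2 // posrE // (lt_le_trans L2 nL2).
have tot : normc d * 8 <= 8 * (L * 2) * (2 * B / L ^+ 2) + 8 * e / L.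
  apply: le_trans (_ : normc (d * dcirc (fun z => z^-1) k (- L) (- L) (L * 2)) <= _).
    by rewrite normcM ler_wpM2l ?normc_ge0.
  have -> : d * dcirc (fun z => z^-1) k (- L) (- L) (L * 2) =
      dcirc q k (- L) (- L) (L * 2) - dcirc g k (- L) (- L) (L * 2).
    by rewrite qd addrK.
  by apply: le_trans (ler_normcB _ _) (lerD qB Hk).
have : normc d * 8 * L <= (8 * (L * 2) * (2 * B / L ^+ 2) + 8 * e / L) * L.
  by rewrite ler_wpM2r // ltW.
have -> : (8 * (L * 2) * (2 * B / L ^+ 2) + 8 * e / L) * L = 32 * B + 8 * e.
  by field; exact: lt0r_neq0.
lra.
Qed.

(** The disc of radius [2 * L] contains the square of half-side [L] of [cauchy_estimate0]. *)
Lemma cauchy_estimate (R : realType) (h : R[i] -> R[i]) (a d : R[i]) (L B : R) :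
  0 < L ->
  (forall z, normc (z - a) <= 2 * L ->
     (exists d', cdiff_at h z d') /\ normc (h z) <= B) ->
  cdiff_at h a d -> normc d * L <= 4 * B.
Proof.
move=> L0 hH hd; apply: (@cauchy_estimate0 _ (fun w => h (a + w))) => //.
  move=> u v uv; have [|[d' hd'] hB] := hH (a + (u +i* v)).
    have -> : a + (u +i* v) - a = u +i* v by rewrite addrC addKr.
    apply: le_trans (ler_normc_ReIm _) _; have -> : 2 * L = L + L by ring.
    by apply: lerD; rewrite ler_norml; move: uv; rewrite /in_square /=; lra.
  by split=> //; exists d'; exact: cdiff_at_shift.
by apply: cdiff_at_shift; rewrite addr0.
Qed.

(** * Mean value inequality and Weierstrass' theorem *)

(** This is [square_bisection] for a predicate that ignores the ordinate. It serves both for adding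
    up estimates and as a continuity argument along a path. *)
Lemma segment_bisection (R : realType) (P : R -> R -> Prop) (a b : R) :
  a < b ->
  (forall x m y, x < m < y -> P x m -> P m y -> P x y) ->
  (forall t, a <= t <= b -> exists2 d, 0 < d &
     forall x y, a <= x -> y <= b -> x < y < x + d -> x <= t <= y -> P x y) ->
  P a b.
Proof.
move=> ab cat loc; have -> : b = a + (b - a) by ring.
apply: (@square_bisection _ (fun x _ l => P x (x + l)) a 0 (b - a)).
- by rewrite subr_gt0.
- move=> x _ l l0 P1 P2 _ _; have -> : x + l * 2 = x + l + l by ring.
  by apply: (cat _ (x + l)) => //; apply/andP; split; lra.
- move=> u v /andP[uab _]; have [|d d0 Hd] := loc u; first by lra.
  exists d => // x y l ld /andP[xu _] ax xb _ _.
  by apply: Hd => //; lra.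
Qed.

Lemma lipschitz_segment (R : realType) (u : R -> R[i]) (K a b : R) :
  a < b ->
  (forall t, a <= t <= b -> exists2 d, 0 < d &
     forall s, a <= s <= b -> `|s - t| < d ->
       normc (u s - u t) <= K * `|s - t|) ->
  normc (u b - u a) <= K * (b - a).
Proof.
move=> ab loc.
apply: (@segment_bisection _ (fun x y => normc (u y - u x) <= K * (y - x))) => //.
  move=> x m y _ h1 h2; have -> : u y - u x = (u y - u m) + (u m - u x) by ring.
  by apply: le_trans (ler_normcD _ _) _; lra.
move=> t /loc[d d0 Hd]; exists d => // x y ax yb xyd xty.
have hy := Hd y ltac:(lra) ltac:(rewrite ger0_norm; lra).
have hx := Hd x ltac:(lra) ltac:(rewrite ler0_norm; lra).
move: hy hx; rewrite ger0_norm; last lra.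
rewrite ler0_norm; last lra.
rewrite [normc (u x - u t)]normc_sub => hy hx.
have -> : u y - u x = (u y - u t) + (u t - u x) by ring.
by apply: le_trans (ler_normcD _ _) _; lra.
Qed.

(** One [K] bounds the linear part, the other the remainder. This is the source of the factor 2 in
    [mean_value] and in [holomorphic_stays_in_chart]. *)
Lemma cdiff_at_lipschitz (R : realType) (h : R[i] -> R[i]) (z d : R[i]) (K : R) :
  0 < K -> normc d <= K -> cdiff_at h z d ->
  exists2 r, 0 < r & forall w, normc (w - z) < r ->
    normc (h w - h z) <= 2 * K * normc (w - z).
Proof.
move=> K0 dK hd; have [r r0 Hr] := hd K K0; exists r => // w wz.
have -> : h w - h z = (h w - h z - d * (w - z)) + d * (w - z) by ring.
apply: le_trans (ler_normcD _ _) _.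
have -> : 2 * K * normc (w - z) = K * normc (w - z) + K * normc (w - z) by ring.
by apply: lerD; [exact: Hr|rewrite normcM ler_wpM2r ?normc_ge0].
Qed.

Lemma normc_segment (R : realType) (a w : R[i]) (s t : R) :
  normc (a + s%:C * (w - a) - (a + t%:C * (w - a))) = `|s - t| * normc (w - a).
Proof.
have -> : a + s%:C * (w - a) - (a + t%:C * (w - a)) = (s - t)%:C * (w - a).
  by rewrite rmorphB /=; ring.
by rewrite normcM normc_real.
Qed.

Lemma mean_value (R : realType) (h : R[i] -> R[i]) (a w : R[i]) (K : R) :
  0 < K ->
  (forall t, 0 <= t <= 1 ->
     exists2 d, cdiff_at h (a + t%:C * (w - a)) d & normc d <= K) ->
  normc (h w - h a) <= 2 * K * normc (w - a).
Proof.
move=> K0 hd; pose u t := h (a + t%:C * (w - a)).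
have -> : h w = u 1 by rewrite /u mul1r addrC subrK.
have -> : h a = u 0 by rewrite /u mul0r addr0.
rewrite -[leRHS]mulr1 -[X in _ * X]subr0; apply: lipschitz_segment => //.
move=> t /hd[d hd' dK]; have [r r0 Hr] := cdiff_at_lipschitz K0 dK hd'.
have nw := normc_ge0 (w - a).
exists (r / (normc (w - a) + 1)); first by rewrite divr_gt0 // ltr_wpDl.
move=> s _ st; rewrite /u -mulrA [normc (w - a) * _]mulrC -normc_segment.
apply: Hr; rewrite normc_segment; apply: le_lt_trans (_ : `|s - t| * (normc (w - a) + 1) < _).
  by rewrite ler_wpM2l // lerDl.
by rewrite -ltr_pdivlMr // ltr_wpDl.
Qed.

(** Pairwise intersecting intervals have a common point. Applied to real and imaginary parts, this
    gives the limit of the derivatives with an explicit error. *)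
Lemma sup_between (R : realType) (f c : nat -> R) :
  (forall k l, f k - c k <= f l + c l) ->
  exists x, forall k, f k - c k <= x <= f k + c k.
Proof.
move=> H; exists (sup (range (fun k => f k - c k))) => k.
have ne : range (fun k => f k - c k) !=set0 by exists (f 0%N - c 0%N), 0%N.
apply/andP; split; last by apply: ge_sup => // _ [l _ <-].
apply: sup_upper_bound; last by exists k.
by split=> //; exists (f 0%N + c 0%N) => _ [l _ <-].
Qed.

Lemma cdiff_atB (R : realType) (h k : R[i] -> R[i]) (z d d' : R[i]) :
  cdiff_at h z d -> cdiff_at k z d' -> cdiff_at (fun w => h w - k w) z (d - d').
Proof.
move=> /is_derive_cdiff_at hd /is_derive_cdiff_at kd.
by apply/is_derive_cdiff_at; exact: is_deriveB.
Qed.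

(* The difference quotients of [g] at [a] are uniform limits of those of the
   approximants, by Cauchy's estimate and the mean value inequality. *)
Lemma cdiff_at_uniform_limit (R : realType) (g : R[i] -> R[i]) (a : R[i]) (r : R) :
  0 < r ->
  (forall e, 0 < e -> exists h, forall z, normc (z - a) < r ->
     (exists d, cdiff_at h z d) /\ normc (g z - h z) <= e) ->
  exists d, cdiff_at g a d.
Proof.
move=> r0 gH.
pose good (h : R[i] -> R[i]) (e : R) := forall z, normc (z - a) < r ->
  (exists d, cdiff_at h z d) /\ normc (g z - h z) <= e.
have deriv h1 h2 e1 e2 z d1 d2 : good h1 e1 -> good h2 e2 ->
    normc (z - a) <= r / 2 -> cdiff_at h1 z d1 -> cdiff_at h2 z d2 ->
    normc (d1 - d2) <= 32 / r * (e1 + e2).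
  move=> G1 G2 za D1 D2.
  suff : normc (d1 - d2) * (r / 8) <= 4 * (e1 + e2).
    rewrite -ler_pdivlMr; last by lra.
    move=> h; apply: le_trans h _.
    by rewrite le_eqVlt; apply/orP; left; apply/eqP; field; exact: lt0r_neq0.
  apply: (cauchy_estimate _ _ (cdiff_atB D1 D2)); first by lra.
  move=> w wz; have wa : normc (w - a) < r.
    have -> : w - a = (w - z) + (z - a) by ring.
    by apply: le_lt_trans (ler_normcD _ _) _; lra.
  have [[d1' D1'] n1] := G1 w wa; have [[d2' D2'] n2] := G2 w wa.
  split; first by exists (d1' - d2'); exact: cdiff_atB.
  have -> : h1 w - h2 w = (g w - h2 w) - (g w - h1 w) by ring.
  by apply: le_trans (ler_normcB _ _) _; lra.
have key h e w : 0 < e -> good h e -> normc (w - a) <= r / 2 ->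
    normc ((g w - h w) - (g a - h a)) <= 128 / r * e * normc (w - a).
  move=> e0 G wa; apply/ler_addgt0Pr => eps eps0.
  (* Replacing [g] by an [eps / 2]-approximant [h2] at both [a] and [w] costs [eps], while [e2 <= e]
     bounds the derivative of [h2 - h] by [64 / r * e] independently of [eps]. *)
  pose e2 := Num.min e (eps / 2).
  have e20 : 0 < e2 by rewrite lt_min e0 divr_gt0.
  have [h2 G2] := gH e2 e20.
  have e2e : e2 <= e by rewrite ge_min lexx.
  have e2eps : e2 <= eps / 2 by rewrite ge_min lexx orbT.
  have nwa := normc_ge0 (w - a).
  have MV : normc ((h2 w - h w) - (h2 a - h a)) <= 2 * (64 / r * e) * normc (w - a).
    apply: (@mean_value _ (fun z => h2 z - h z)).
      by rewrite mulr_gt0 // divr_gt0.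
    move=> t t01; set z := a + _; have za : normc (z - a) <= r / 2.
      rewrite /z addrC addKr normcM normc_real.
      by apply: le_trans wa; rewrite ger0_norm ?ler_piMl //; lra.
    have [|[d2 D2] _] := G2 z; first by lra.
    have [|[d1 D1] _] := G z; first by lra.
    exists (d2 - d1); first exact: cdiff_atB.
    apply: le_trans (deriv _ _ _ _ _ _ _ G2 G za D2 D1) _.
    have -> : 64 / r * e = 32 / r * (e + e) by ring.
    by rewrite ler_wpM2l ?divr_ge0 ?(ltW r0) // lerD2r.
  have -> : (g w - h w) - (g a - h a) =
    ((h2 w - h w) - (h2 a - h a)) + ((g w - h2 w) - (g a - h2 a)) by ring.
  apply: le_trans (ler_normcD _ _) _; apply: lerD.
    apply: le_trans MV _; rewrite le_eqVlt; apply/orP; left; apply/eqP; ring.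
  apply: le_trans (ler_normcB _ _) _.
  have [|_ n1] := G2 w; first by lra.
  have [|_ n2] := G2 a; first by rewrite subrr normc0.
  lra.
pose e k : R := k.+1%:R^-1.
have e0 k : 0 < e k by rewrite invr_gt0 ltr0n.
have [h Gh] := choice (fun k => gH (e k) (e0 k)).
have hd k : exists d, cdiff_at (h k) a d.
  by have [|] := Gh k a; rewrite ?subrr ?normc0.
have [d Hd] := choice hd.
have dd k l : normc (d k - d l) <= 32 / r * e k + 32 / r * e l.
  rewrite -mulrDr; apply: (deriv _ _ _ _ a _ _ (Gh k) (Gh l)) => //.
  by rewrite subrr normc0 divr_ge0 // ltW.
have [x Hx] := @sup_between _ (fun k => complex.Re (d k)) (fun k => 32 / r * e k) ltac:(
  by move=> k l; have := ler_Re_normc (d k - d l); have := dd k l;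
    case: (d k) => p1 q1; case: (d l) => p2 q2; rewrite /= ler_norml; lra).
have [y Hy] := @sup_between _ (fun k => complex.Im (d k)) (fun k => 32 / r * e k) ltac:(
  by move=> k l; have := ler_Im_normc (d k - d l); have := dd k l;
    case: (d k) => p1 q1; case: (d l) => p2 q2; rewrite /= ler_norml; lra).
have near_d k : normc (d k - (x +i* y)) <= 64 / r * e k.
  apply: le_trans (ler_normc_ReIm _) _.
  have -> : 64 / r * e k = 32 / r * e k + 32 / r * e k by ring.
  move: (Hx k) (Hy k); case: (d k) => p q /= hx hy.
  by apply: lerD; rewrite ler_norml; lra.
exists (x +i* y) => eps eps0.
(* 192 = 128 + 64, the constants of [key] and [near_d]; the other [eps / 2] is for the remainder of
   [h k]. *)
have [k Hk] : exists k, 192 / r * e k <= eps / 2.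
  exists (Num.truncn (192 / r / (eps / 2))).
  rewrite /e ler_pdivrMr ?ltr0n // [leRHS]mulrC -ler_pdivrMr; last by lra.
  exact/ltW/truncnS_gt.
have [s s0 Hs] := Hd k (eps / 2) ltac:(lra).
exists (Num.min s (r / 2)); first by rewrite lt_min s0 divr_gt0.
move=> w; rewrite lt_min => /andP[ws /ltW wr].
have h1 := key _ _ _ (e0 k) (Gh k) wr; have h2 := Hs w ws.
have h3 : normc ((d k - (x +i* y)) * (w - a)) <= 64 / r * e k * normc (w - a).
  by rewrite normcM ler_wpM2r // normc_ge0.
have -> : g w - g a - (x +i* y) * (w - a) = ((g w - h k w) - (g a - h k a)) +
    (h k w - h k a - d k * (w - a)) + (d k - (x +i* y)) * (w - a) by ring.
apply: le_trans (ler_normcD _ _) _.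
apply: le_trans (lerD (ler_normcD _ _) (lexx _)) _.
apply: le_trans (lerD (lerD h1 h2) h3) _.
have -> : 128 / r * e k * normc (w - a) + eps / 2 * normc (w - a) +
    64 / r * e k * normc (w - a) = (192 / r * e k + eps / 2) * normc (w - a) by ring.
by rewrite ler_wpM2r ?normc_ge0 //; lra.
Qed.

(** * Topology of C^n and Hermitian forms *)

Lemma nbhs_rowP (R : realType) n (x : 'rV[R[i]]_n) (A : set 'rV[R[i]]_n) :
  nbhs x A <-> exists2 r : R, 0 < r &
    forall y : 'rV[R[i]]_n, (forall k, normc (y ord0 k - x ord0 k) < r) -> A y.
Proof.
split=> [/nbhs_ballP[e /= e0 eA]|[r r0 rA]].
  have ee : e = (complex.Re e)%:C by rewrite RRe_real // gtr0_real.
  move: (e0); rewrite ee ltcR => e0'.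
  exists (complex.Re e) => // y yx; apply: eA; split=> // i j.
  by rewrite ord1 -ball_normE /= ee norm_normc ltcR normc_sub.
apply/nbhs_ballP; exists r%:C => /=; first by rewrite ltcR.
move=> y [_ yx]; apply: rA => k.
by have := yx ord0 k; rewrite -ball_normE /= norm_normc ltcR normc_sub.
Qed.

Lemma cvg_complexP (R : realType) (T : Type) (F : set_system T) (f : T -> R[i])
    (l : R[i]) : Filter F ->
  (f @ F --> l) <-> (forall e, 0 < e -> \forall t \near F, normc (f t - l) < e).
Proof.
move=> FF; split=> [fl e e0|H A].
  by apply: (fl [set w | normc (w - l) < e]); apply/nbhs_complexP; exists e.
by move=> /nbhs_complexP[r r0 rA]; apply: filterS (H r r0) => t; exact: rA.
Qed.

Lemma continuous_complexP (R : realType) (T : topologicalType) (f : T -> R[i])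
    (x : T) :
  {for x, continuous f} <->
  (forall e, 0 < e -> \forall t \near x, normc (f t - f x) < e).
Proof. exact: (@cvg_complexP _ _ _ _ _ (nbhs_filter x)). Qed.

Lemma cvg_rowP (R : realType) n (T : Type) (F : set_system T)
    (f : T -> 'rV[R[i]]_n) (l : 'rV[R[i]]_n) : Filter F ->
  (f @ F --> l) <-> (forall k, f t ord0 k @[t --> F] --> l ord0 k).
Proof.
move=> FF; split=> [fl k|H A].
  apply/cvg_complexP => e e0.
  apply: (fl [set y : 'rV[R[i]]_n | normc (y ord0 k - l ord0 k) < e]).
  by apply/nbhs_rowP; exists e => // y; exact.
move=> /nbhs_rowP[r r0 rA].
have : \forall t \near F, forall k, normc (f t ord0 k - l ord0 k) < r.
  by apply: filter_forall => k; move: (H k) => /cvg_complexP/(_ r r0).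
by apply: filterS => t; exact: rA.
Qed.

Lemma differentiable_cdiff_at (R : realType) n (F : R[i] -> 'rV[R[i]]_n) (z : R[i]) k :
  differentiable F z ->
  cdiff_at (fun w => F w ord0 k) z (('d F z (1 : R[i])) ord0 k).
Proof.
move=> dF; apply/is_derive_cdiff_at.
have /cvg_ex[/= l ll] := @diff_derivable _ _ _ F z (1 : R[i]) dF.
have lE : 'd F z (1 : R[i]) = l by rewrite -deriveE //; exact: cvg_lim.
rewrite lE; have /cvg_rowP/(_ k) lk := ll.
have H : (fun h : R[i] => h^-1 *: (((fun w => F w ord0 k) \o shift z) (h *: 1)
    - F z ord0 k)) @ 0^' --> l ord0 k.
  by apply: cvg_trans lk; apply: near_eq_cvg; near=> h; rewrite !mxE.
by split; [apply/cvg_ex; exists (l ord0 k)|exact: cvg_lim].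
Unshelve. all: by end_near. Qed.

Lemma cdiff_at_differentiable (R : realType) n (F : R[i] -> 'rV[R[i]]_n) (z : R[i]) :
  (forall k, exists d, cdiff_at (fun w => F w ord0 k) z d) -> differentiable F z.
Proof.
move=> /choice[d Hd]; apply/derivable1_diffP/cvg_ex; exists (\row_k d k).
apply/cvg_rowP => k; rewrite mxE.
have /is_derive_cdiff_at[dk <-] := Hd k.
apply: cvg_trans dk; apply: near_eq_cvg; near=> h; rewrite !mxE //.
Unshelve. all: by end_near. Qed.

Lemma conjc_continuous (R : realType) : continuous (@conjc R).
Proof.
move=> z; apply/continuous_complexP => e e0; apply/nbhs_complexP; exists e => // w wz.
rewrite -rmorphB; have -> // : normc (w - z)^* = normc (w - z).
by case: (w - z) => a b /=; rewrite sqrrN.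
Qed.

Lemma complex_continuous (R : realType) (T : topologicalType) (f : T -> R[i]) (x : T) :
  {for x, continuous (fun t => complex.Re (f t))} ->
  {for x, continuous (fun t => complex.Im (f t))} ->
  {for x, continuous f}.
Proof.
move=> /cvgrPdist_lt cr /cvgrPdist_lt ci; apply/continuous_complexP => e e0.
have e2 : 0 < e / 2 by rewrite divr_gt0.
near=> t.
apply: le_lt_trans (ler_normc_ReIm _) _.
have hr : `|complex.Re (f x) - complex.Re (f t)| < e / 2 by near: t; exact: cr.
have hi : `|complex.Im (f x) - complex.Im (f t)| < e / 2 by near: t; exact: ci.
have -> : complex.Re (f t - f x) = - (complex.Re (f x) - complex.Re (f t)).
  by case: (f t) => a b; case: (f x) => c d /=; ring.
have -> : complex.Im (f t - f x) = - (complex.Im (f x) - complex.Im (f t)).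
  by case: (f t) => a b; case: (f x) => c d /=; ring.
by rewrite !normrN; lra.
Unshelve. all: by end_near. Qed.

Lemma compact_disc (R : realType) (a : R[i]) (r : R) :
  compact [set z : R[i] | normc (z - a) <= r].
Proof.
have cS : compact (`[- r, r]%classic `*` `[- r, r]%classic : set (R * R)).
  by apply: compact_setX; exact: segment_compact.
pose f (q : R * R) := a + (q.1 +i* q.2).
have cf : continuous f.
  move=> q; apply: complex_continuous.
    rewrite (_ : (fun t => _) = (fun t => complex.Re a + t.1)); last first.
      by apply/funext => t; rewrite /f; case: (a).
    by apply: cvgD; [exact: cvg_cst|exact: cvg_fst].
  rewrite (_ : (fun t => _) = (fun t => complex.Im a + t.2)); last first.
    by apply/funext => t; rewrite /f; case: (a).
  by apply: cvgD; [exact: cvg_cst|exact: cvg_snd].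
have cfS := continuous_compact (continuous_subspaceT cf) cS.
apply: (subclosed_compact _ cfS).
  rewrite (_ : mkset _ = ~` [set z | r < normc (z - a)]); last first.
    by apply/seteqP; split=> z /=; rewrite leNgt => /negP.
  apply: open_closedC; rewrite openE => z /= rz; apply/nbhs_complexP; exists (normc (z - a) - r).
    by rewrite subr_gt0.
  move=> w wz /=; have : normc (z - a) <= normc (w - z) + normc (w - a).
    have -> : z - a = - (w - z) + (w - a) by ring.
    by apply: le_trans (ler_normcD _ _) _; rewrite normc_opp.
  lra.
move=> z /= za; exists (complex.Re (z - a), complex.Im (z - a)).
  have h1 := ler_Re_normc (z - a); have h2 := ler_Im_normc (z - a).
  by split=> /=; rewrite in_itv /= -ler_norml; [exact: le_trans h1 za|exact: le_trans h2 za].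
by rewrite /f /=; case: (z) => p q; case: (a) => s t /=; congr (_ +i* _); ring.
Qed.

Definition box (R : realType) n (x : 'rV[R[i]]_n) (r : R) : set 'rV[R[i]]_n :=
  [set y | forall k, normc (y ord0 k - x ord0 k) <= r].

Lemma compact_box (R : realType) n (x : 'rV[R[i]]_n) (r : R) : compact (box x r).
Proof.
apply: (@rV_compact _ _ (fun k => [set z : R[i] | normc (z - x ord0 k) <= r])).
by move=> k; exact: compact_disc.
Qed.

Lemma nbhs_box (R : realType) n (x : 'rV[R[i]]_n) (r : R) :
  0 < r -> nbhs x (box x r).
Proof. by move=> r0; apply/nbhs_rowP; exists r => // y yx k; exact: ltW. Qed.

Lemma nbhs_sub_box (R : realType) n (x : 'rV[R[i]]_n) (A : set 'rV[R[i]]_n) :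
  nbhs x A -> exists2 r : R, 0 < r & box x r `<=` A.
Proof.
move=> /nbhs_rowP[r r0 rA]; exists (r / 2); first by rewrite divr_gt0.
by move=> y yx; apply: rA => k; apply: le_lt_trans (yx k) _; lra.
Qed.

Lemma normc_conjc (R : realType) (z : R[i]) : normc z^* = normc z.
Proof. by case: z => a b /=; rewrite sqrrN. Qed.

Lemma mulc_conjc (R : realType) (z : R[i]) : z * z^* = (normc z ^+ 2)%:C.
Proof. by rewrite -sqr_normc norm_normc rmorphXn. Qed.

Lemma hformZ (R : realType) n (h : 'M[R[i]]_n) (a : R[i]) (v : 'rV[R[i]]_n) :
  hform h (a *: v) = (normc a ^+ 2)%:C * hform h v.
Proof.
rewrite /hform mulr_sumr; apply: eq_bigr => k _.
rewrite mulr_sumr; apply: eq_bigr => l _.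
by rewrite !mxE -mulc_conjc rmorphM /=; ring.
Qed.

Lemma ReM_real (R : realType) (a : R) (z : R[i]) :
  complex.Re (a%:C * z) = a * complex.Re z.
Proof. by case: z => x y /=; rewrite mul0r subr0. Qed.

Lemma cvg_hform (R : realType) n (T : Type) (F : set_system T)
    (h : T -> 'M[R[i]]_n) (v : T -> 'rV[R[i]]_n) (h0 : 'M[R[i]]_n)
    (v0 : 'rV[R[i]]_n) : Filter F ->
  (forall a b, h t a b @[t --> F] --> h0 a b) -> v @ F --> v0 ->
  hform (h t) (v t) @[t --> F] --> hform h0 v0.
Proof.
move=> FF hh /cvg_rowP vv; rewrite /hform.
apply: cvg_big => [|a _]; first exact: add_continuous.
apply: cvg_big => [|b _]; first exact: add_continuous.
apply: cvgM; first exact: cvgM.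
by apply: (cvg_comp _ _ (vv b)); exact: conjc_continuous.
Qed.

(** By homogeneity it suffices to bound the form below on the compact slices [S k]: a nonzero vector
    divided by its largest coordinate lies in one of them, and that coordinate dominates all the
    others. *)
Lemma hform_lower_bound (R : realType) n (T : topologicalType)
    (h : T -> 'M[R[i]]_n) (x : T) :
  (forall a b, {for x, continuous (fun y => h y a b)}) ->
  (forall v, v != 0 -> 0 < hform (h x) v) ->
  exists2 c : R, 0 < c & \forall y \near x, forall (v : 'rV[R[i]]_n) k,
    c * normc (v ord0 k) ^+ 2 <= complex.Re (hform (h y) v).
Proof.
move=> hc hpos.
pose S k : set 'rV[R[i]]_n := [set v | v ord0 k = 1 /\ forall j, normc (v ord0 j) <= 1].
have cS k : compact (S k).
  pose A j : set R[i] := if j == k then [set 1] else [set z | normc (z - 0) <= 1].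
  have cA : compact [set v : 'rV[R[i]]_n | forall j, A j (v ord0 j)].
    apply: rV_compact => j; rewrite /A; case: ifP => _.
      exact: compact_set1.
    exact: compact_disc.
  rewrite (_ : S k = [set v : 'rV[R[i]]_n | forall j, A j (v ord0 j)]) //.
  apply/seteqP; split=> v /=.
    move=> [vk vj] j; rewrite /A; case: eqP => [->|_]; first by [].
    by rewrite /= subr0.
  move=> H; split; first by have := H k; rewrite /A eqxx.
  move=> j; have := H j; rewrite /A; case: eqP => [_ /= ->|_ /=].
    by rewrite normc1.
  by rewrite subr0.
(* The constant tends to 0 from the right while [y] tends to [x], so one covering argument yields
   both the constant and the neighbourhood. *)
pose F := filter_prod (0 : R)^'+ (nbhs x).
have near_S k : \forall cy \near F, forall v, S k v ->
    cy.1 < complex.Re (hform (h cy.2) v).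
  move: (cS k) => /compact_near_coveringP/(_ _ F
    (fun cy v => cy.1 < complex.Re (hform (h cy.2) v))); apply.
  move=> v0 [v0k _].
  have v0N0 : v0 != 0 by apply/eqP => E; move: v0k; rewrite E mxE => /eqP; rewrite eq_sym oner_eq0.
  have := hpos v0 v0N0; rewrite ltcE => /andP[_ /=]; set m := complex.Re _ => m0.
  have cv : hform (h t.2.2) t.1 @[t --> filter_prod (nbhs v0) F] --> hform (h x) v0.
    apply: cvg_hform => [a b|]; last exact: cvg_fst.
    apply: (@cvg_comp _ _ _ (fun t : 'rV[R[i]]_n * (R * T) => t.2.2)
      (fun y => h y a b)); last exact: hc.
    by apply: (cvg_comp _ _ cvg_snd); exact: cvg_snd.
  have m2 : 0 < m / 2 by rewrite divr_gt0.
  have hn : \forall t \near filter_prod (nbhs v0) F,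
    normc (hform (h t.2.2) t.1 - hform (h x) v0) < m / 2.
    by move: cv => /cvg_complexP/(_ _ m2).
  have cn : \forall t \near filter_prod (nbhs v0) F, t.2.1 < m / 2.
    have h1 : \forall c \near (0 : R)^'+, c < m / 2 by exact: nbhs_right_lt.
    have h2 : (fun t : 'rV[R[i]]_n * (R * T) => t.2.1) @ filter_prod (nbhs v0) F --> (0 : R)^'+.
      by apply: (cvg_comp _ _ cvg_snd); exact: cvg_fst.
    exact: h2 h1.
  apply: filterS2 hn cn => -[v [c y]] /= h1 h2.
  have := ler_Re_normc (hform (h y) v - hform (h x) v0).
  have -> : complex.Re (hform (h y) v - hform (h x) v0) = complex.Re (hform (h y) v) - m.
    by rewrite /m; case: (hform (h y) v) => a b; case: (hform (h x) v0).
  by rewrite ler_norml; lra.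
have near_all : \forall cy \near F, forall k v, S k v ->
    cy.1 < complex.Re (hform (h cy.2) v).
  exact: filter_forall.
move: near_all => [[A B] [/= A0 Bx] AB].
have [c [Ac c0]] : exists c, A c /\ 0 < c.
  near (0 : R)^'+ => c; exists c; split; near: c => //.
  exact: nbhs_right_gt.
exists c => //; apply: filterS Bx => y By v k.
have [->|v0] := eqVneq v 0.
  rewrite mxE normc0 expr0n /= mulr0 -(scale0r (0 : 'rV[R[i]]_n)) hformZ ReM_real.
  by rewrite normc0 expr0n mul0r.
pose j := [arg max_(j > k) normc (v ord0 j)]%O.
have vj l : normc (v ord0 l) <= normc (v ord0 j).
  by rewrite /j; case: arg_maxP => // j0 _; exact.
have vj0 : 0 < normc (v ord0 j).
  rewrite lt0r normc_ge0 andbT; apply: contra v0 => /eqP nj.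
  apply/eqP/rowP => l; rewrite mxE; apply/eqP; rewrite -normc_eq0 eq_le normc_ge0 andbT.
  by rewrite -nj.
have Sv : S j ((v ord0 j)^-1 *: v).
  split=> [|l]; rewrite mxE; first by rewrite mulVf // -normc_gt0.
  by rewrite normcM normcV mulrC ler_pdivrMr // mul1r.
have := AB (c, y) (conj Ac By) j _ Sv.
rewrite /= hformZ ReM_real normcV exprVn mulrC ltr_pdivlMr ?exprn_gt0 // => /ltW.
apply: le_trans; rewrite ler_wpM2l ?(ltW c0) //.
by rewrite lerXn2r ?nnegrE ?normc_ge0.
Unshelve. all: by end_near. Qed.

Lemma hform_upper_bound (R : realType) n (T : topologicalType)
    (h : T -> 'M[R[i]]_n) (x : T) :
  (forall a b, {for x, continuous (fun y => h y a b)}) ->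
  exists2 C : R, 0 < C & \forall y \near x, forall (v : 'rV[R[i]]_n) B,
    (forall k, normc (v ord0 k) <= B) -> complex.Re (hform (h y) v) <= C * B ^+ 2.
Proof.
move=> hc.
pose C := \sum_(a < n) \sum_(b < n) (normc (h x a b) + 1).
have C0 : 0 <= C.
  by apply: sumr_ge0 => a _; apply: sumr_ge0 => b _; rewrite addr_ge0 ?normc_ge0.
(* The sum [C] is empty for [n = 0]; adding 1 makes the constant positive in every dimension. *)
exists (C + 1); first by rewrite ltr_wpDl.
have hn : \forall y \near x, forall a b, normc (h y a b) <= normc (h x a b) + 1.
  apply: filter_forall => a; apply: filter_forall => b.
  have /continuous_complexP/(_ 1 ltr01) := hc a b.
  apply: filterS => y yx; rewrite -[h y a b](subrK (h x a b)) [leRHS]addrC.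
  by apply: le_trans (ler_normcD _ _) _; rewrite lerD2r ltW.
apply: filterS hn => y hy v B vB.
apply: le_trans (ler_norm _) _; apply: le_trans (ler_Re_normc _) _.
apply: (@le_trans _ _ (C * B ^+ 2)); last first.
  by rewrite ler_wpM2r ?sqr_ge0 // lerDl.
rewrite /C mulr_suml; apply: le_trans (ler_normc_sum _ _) _; apply: ler_sum => a _.
rewrite mulr_suml; apply: le_trans (ler_normc_sum _ _) _; apply: ler_sum => b _.
rewrite !normcM normc_conjc expr2 mulrA.
by apply: ler_pM; rewrite ?mulr_ge0 ?normc_ge0 //; apply: ler_pM; rewrite ?normc_ge0.
Qed.

(** * Maps into the manifold *)

Definition chart_ball (R : realType) n (M : topologicalType)
    (X : complex_atlas R n M) (i : chart_index X) (p : M) (r : R) : set M :=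
  [set q | chart_dom X i q /\ box (chart_map X i p) r (chart_map X i q)].

Lemma nbhs_chart_ball (R : realType) n (M : topologicalType)
    (X : complex_atlas R n M) i (p : M) (r : R) :
  chart_dom X i p -> 0 < r -> nbhs p (chart_ball (X := X) i p r).
Proof.
move=> ip r0; apply: filterI.
  by apply: open_nbhs_nbhs; split=> //; exact: chart_dom_open.
by have := chart_map_continuous ip; apply; exact: nbhs_box.
Qed.

Lemma chart_ball_sub (R : realType) n (M : topologicalType)
    (X : complex_atlas R n M) i (p : M) (U : set M) :
  chart_dom X i p -> nbhs p U ->
  exists2 r : R, 0 < r & chart_ball (X := X) i p r `<=` U /\
    box (chart_map X i p) r `<=` chart_map X i @` chart_dom X i.
Proof.
move=> ip pU.
have im : (chart_map X i @` chart_dom X i) (chart_map X i p) by exists p.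
have N1 : nbhs (chart_map X i p) (chart_map X i @` chart_dom X i).
  by apply: open_nbhs_nbhs; split=> //; exact: chart_map_open.
have N2 : nbhs (chart_map X i p) (chart_inv X i @^-1` U).
  by apply: (chart_inv_continuous im); rewrite chart_mapK.
have [r r0 rA] := nbhs_sub_box (filterI N1 N2).
exists r => //; split=> [q [iq qb]|y yb]; last by have [] := rA _ yb.
by have [_] := rA _ qb; rewrite /= chart_mapK.
Qed.

(** The ball is the continuous image of a compact polydisc, and compact sets of a Hausdorff space
    are closed. Closedness in the chart domain alone would not stop a path from leaving the
    chart. *)
Lemma closed_chart_ball (R : realType) n (M : topologicalType)
    (X : complex_atlas R n M) i (p : M) (r : R) :
  hausdorff_space M ->
  box (chart_map X i p) r `<=` chart_map X i @` chart_dom X i ->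
  closed (chart_ball (X := X) i p r).
Proof.
move=> hM bi.
rewrite (_ : chart_ball _ _ _ = chart_inv X i @` box (chart_map X i p) r).
  apply: compact_closed => //; apply: continuous_compact; last exact: compact_box.
  by apply: continuous_in_subspaceT => y /set_mem yb; apply: chart_inv_continuous; exact: bi.
apply/seteqP; split=> [q [iq qb]|_ [y yb <-]].
  by exists (chart_map X i q) => //; rewrite chart_mapK.
by have [q iq qy] := bi y yb; rewrite -qy chart_mapK //; split=> //; rewrite qy.
Qed.

Lemma chart_metric_bounds (R : realType) n (M : topologicalType)
    (X : complex_atlas R n M) (H : hermitian_metric X) i (p : M) :
  chart_dom X i p ->
  exists (c C : R), [/\ 0 < c, 0 < C & \forall q \near p,
    forall v : 'rV[R[i]]_n,
    (forall k, c * normc (v ord0 k) ^+ 2 <= complex.Re (hform (hmx H i q) v)) /\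
    (forall B, (forall k, normc (v ord0 k) <= B) ->
       complex.Re (hform (hmx H i q) v) <= C * B ^+ 2)].
Proof.
move=> ip.
have im : (chart_map X i @` chart_dom X i) (chart_map X i p) by exists p.
pose h y := hmx H i (chart_inv X i y).
have hc a b : {for chart_map X i p, continuous (fun y => h y a b)}.
  have [[cr _] [ci _]] := hmx_smooth H i a b 0%N.
  by apply: complex_continuous; [exact: cr|exact: ci].
have hpos v : v != 0 -> 0 < hform (h (chart_map X i p)) v.
  by rewrite /h chart_mapK // => v0; exact: hmx_gt0.
have [c c0 cH] := hform_lower_bound hc hpos.
have [C C0 CH] := hform_upper_bound hc.
exists c, C; split=> //.
have pc := chart_map_continuous ip.
have pd : \forall q \near p, chart_dom X i q.
  by apply: open_nbhs_nbhs; split=> //; exact: chart_dom_open.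
apply: filterS3 pd (pc _ cH) (pc _ CH) => q iq /= h1 h2 v.
by move: (h1 v) (h2 v); rewrite /h chart_mapK.
Qed.

Lemma near_segment (R : realType) (a w : R[i]) (t : R) (A : set R[i]) :
  nbhs (a + t%:C * (w - a)) A ->
  exists2 d : R, 0 < d & forall s, `|s - t| < d -> A (a + s%:C * (w - a)).
Proof.
move=> /nbhs_complexP[r r0 rA]; have nw := normc_ge0 (w - a).
exists (r / (normc (w - a) + 1)); first by rewrite divr_gt0 // ltr_wpDl.
move=> s; rewrite ltr_pdivlMr ?ltr_wpDl // => st; apply: rA.
rewrite normc_segment; apply: le_lt_trans st.
by rewrite ler_wpM2l // lerDl.
Qed.

(* The path cannot leave the chart: the closed ball is closed in [M], and while
   the path is in it, its coordinates move at speed at most [2 L]. *)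
Lemma holomorphic_stays_in_chart (R : realType) n (M : topologicalType)
    (X : complex_atlas R n M) (F : R[i] -> M) i (p : M) (r L : R) (a w : R[i]) :
  hausdorff_space M -> holomorphic_map X F -> 0 < L ->
  box (chart_map X i p) r `<=` chart_map X i @` chart_dom X i ->
  chart_ball (X := X) i p (r / 2) (F a) ->
  (forall t, 0 <= t <= 1 -> let z := a + t%:C * (w - a) in
     chart_ball (X := X) i p r (F z) ->
     forall k, normc (('d (chart_map X i \o F) z (1 : R[i])) ord0 k) <= L) ->
  2 * L * normc (w - a) <= r / 2 ->
  chart_ball (X := X) i p r (F w).
Proof.
move=> hM [Fc Fd] L0 bi [ia ba] speed Lr.
pose z (t : R) := a + t%:C * (w - a).
pose u t := chart_map X i (F (z t)).
have z0 : z 0 = a by rewrite /z mul0r addr0.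
have u0 : u 0 = chart_map X i (F a) by rewrite /u z0.
have z1 : z 1 = w by rewrite /z mul1r addrC subrK.
have nw := normc_ge0 (w - a).
(* The bound is measured from the start and linear in [t], so local increments add up. On [[0, 1]]
   it implies membership in the ball, where the speed bound applies. *)
pose Q t := chart_dom X i (F (z t)) /\
  forall k, normc (u t ord0 k - u 0 ord0 k) <= 2 * L * normc (w - a) * t.
have Qball t : 0 <= t <= 1 -> Q t -> chart_ball (X := X) i p r (F (z t)).
  move=> t01 [it ut]; split=> // k.
  have -> : chart_map X i (F (z t)) ord0 k - chart_map X i p ord0 k =
    (u t ord0 k - u 0 ord0 k) + (u 0 ord0 k - chart_map X i p ord0 k) by rewrite /u; ring.
  apply: le_trans (ler_normcD _ _) _; have := ba k; have := ut k.
  rewrite -u0 => h1 h2.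
  have : 2 * L * normc (w - a) * t <= 2 * L * normc (w - a).
    by rewrite ler_piMr ?mulr_ge0 ?(ltW L0) //; lra.
  lra.
suff : Q 0 -> Q 1.
  move=> H; rewrite -z1; apply: Qball; first by lra.
  by apply: H; split=> [|k]; rewrite ?z0 // subrr normc0 mulr0.
apply: (@segment_bisection _ (fun x y => Q x -> Q y)) => // [x m y _ h1 h2 /h1 /h2 //|t t01].
have Fz : {for z t, continuous F} by exact: Fc.
(* Outside the ball, closedness keeps nearby points outside as well, so [Q x] is false there and the
   implication is vacuous. *)
have [tb|tb] := pselect (chart_ball (X := X) i p r (F (z t))); last first.
  have N : nbhs (z t) (F @^-1` (~` chart_ball (X := X) i p r)).
    apply: Fz; apply: open_nbhs_nbhs; split=> //; apply: closed_openC.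
    exact: closed_chart_ball.
  have [d d0 dA] := near_segment N; exists d => // x y x0 y1 xy xty Qx.
  exfalso; apply: (dA x); first by rewrite ler0_norm; lra.
  by apply: Qball Qx; lra.
have [it bt] := tb.
have N1 : nbhs (z t) (F @^-1` chart_dom X i).
  by apply: Fz; apply: open_nbhs_nbhs; split=> //; exact: chart_dom_open.
have N2 : \forall v \near z t, forall k,
    normc (chart_map X i (F v) ord0 k - u t ord0 k) <= 2 * L * normc (v - z t).
  apply: (@filter_forall _ _ _ _ (nbhs_filter (z t))) => k.
  have [s s0 sH] := cdiff_at_lipschitz L0 (speed t t01 tb k)
    (differentiable_cdiff_at k (Fd _ _ it)).
  by apply/nbhs_complexP; exists s.
have [d d0 dA] := near_segment (filterI N1 N2); exists d => // x y x0 y1 xy xty [ix ux].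
have [iy uy] := dA y ltac:(rewrite ger0_norm; lra).
have [_ ux'] := dA x ltac:(rewrite ler0_norm; lra).
split=> // k; have := uy k; have := ux' k; have := ux k.
rewrite !normc_segment -![chart_map X i (F (a + _))]/(u _).
rewrite (@ger0_norm _ (y - t)); last lra.
rewrite (@ler0_norm _ (x - t)); last lra.
rewrite [normc (u x ord0 k - u t ord0 k)]normc_sub => h1 h2 h3.
have -> : u y ord0 k - u 0 ord0 k = (u y ord0 k - u t ord0 k) +
  ((u t ord0 k - u x ord0 k) + (u x ord0 k - u 0 ord0 k)) by ring.
apply: le_trans (ler_normcD _ _) _.
apply: le_trans (lerD (lexx _) (ler_normcD _ _)) _.
apply: le_trans (lerD h3 (lerD h2 h1)) _.
by rewrite le_eqVlt; apply/orP; left; apply/eqP; ring.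
Qed.

Lemma chart_speed_bound (R : realType) n (M : topologicalType)
    (X : complex_atlas R n M) (H : hermitian_metric X) (F : R[i] -> M) i (z : R[i])
    (c K : R) :
  holomorphic_map X F -> chart_dom X i (F z) -> 0 < c ->
  (forall (v : 'rV[R[i]]_n) k,
     c * normc (v ord0 k) ^+ 2 <= complex.Re (hform (hmx H i (F z)) v)) ->
  tangent_norm H (differential X F z (1 : R[i])) <= K ->
  forall k, normc (('d (chart_map X i \o F) z (1 : R[i])) ord0 k) <=
    Num.sqrt (K ^+ 2 / c).
Proof.
move=> Fh iz c0 cH; rewrite (tangent_norm_differential H _ Fh iz).
set v := 'd _ _ _ => vK k; set h := complex.Re _ in vK.
have h1 : c * normc (v ord0 k) ^+ 2 <= h by exact: cH.
have h0 : 0 <= h by apply: le_trans h1; rewrite mulr_ge0 ?sqr_ge0 ?(ltW c0).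
have K0 : 0 <= K by apply: le_trans vK; exact: sqrtr_ge0.
have hK : h <= K ^+ 2.
  by rewrite -(sqr_sqrtr h0) lerXn2r ?nnegrE ?sqrtr_ge0.
rewrite -[leLHS]ger0_norm ?normc_ge0 // -sqrtr_sqr; apply: ler_wsqrtr.
by rewrite ler_pdivlMr // mulrC; exact: le_trans hK.
Qed.

(** The starting value [q = F j a] is treated as a point of the compact space [M]. Covering [M] by
    small chart balls gives a neighbourhood of [a] that depends on [q] only locally, hence one that
    is valid for all [j]. *)
Lemma equicontinuous_bounded_speed (R : realType) n (M : uniformType)
    (X : complex_atlas R n M) (H : hermitian_metric X) (I : Type) (W : set I)
    (F : I -> R[i] -> M) (a : R[i]) (d K : R) :
  hausdorff_space M -> compact [set: M] -> 0 < d ->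
  (forall j, W j -> holomorphic_map X (F j)) ->
  (forall j z, W j -> normc (z - a) < d ->
     tangent_norm H (differential X (F j) z (1 : R[i])) <= K) ->
  forall E, entourage E -> \forall z \near a, forall j, W j -> E (F j a, F j z).
Proof.
move=> hM cM d0 Fh FK E entE.
have := cM => /compact_near_coveringP/(_ _ (nbhs a)
  (fun z q => forall j, W j -> F j a = q -> E (q, F j z))) main.
suff : \forall z \near a, [set: M] `<=`
    (fun q => forall j, W j -> F j a = q -> E (q, F j z)).
  by apply: filterS => z zH j Wj; exact: (zH (F j a)).
apply: main => p _.
have ip := chart_atP X p; set i := chart_at X p in ip.
have [c [C [c0 _ pc]]] := chart_metric_bounds H ip.
have entS : entourage (split_ent E) by exact: entourage_split_ent.
have pE : \forall q \near p, split_ent E (p, q) /\ split_ent E (q, p).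
  apply: filterI; first by have := nbhs_entourage p entS; apply: filterS => q /xsectionP.
  have := nbhs_entourage p (entourage_inv entS).
  by apply: filterS => q /xsectionP.
have [r r0 [rU bi]] := chart_ball_sub ip (filterI pc pE).
pose L := Num.sqrt (K ^+ 2 / c) + 1.
have L0 : 0 < L by rewrite ltr_wpDl // sqrtr_ge0.
have near_q : \forall q \near p, chart_ball (X := X) i p (r / 2) q.
  by apply: nbhs_chart_ball => //; rewrite divr_gt0.
(* [d] keeps the segment where the speed is bounded, and [r / (4 * L)] makes the displacement
   [2 * L * |z - a|] at most [r / 2]. *)
have e0 : 0 < Num.min d (r / (4 * L)) by rewrite lt_min d0 divr_gt0 // mulr_gt0.
have near_z : \forall z \near a, normc (z - a) < Num.min d (r / (4 * L)).
  by apply/nbhs_complexP; exists (Num.min d (r / (4 * L))).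
exists ([set q | chart_ball (X := X) i p (r / 2) q],
  [set z | normc (z - a) < Num.min d (r / (4 * L))]); first by split.
move=> [q z] /= [qb]; rewrite lt_min => /andP[zd zr] j Wj Fq.
have big : chart_ball (X := X) i p r (F j z).
  apply: (@holomorphic_stays_in_chart _ _ _ _ _ _ _ _ _ a z hM (Fh j Wj) L0 bi).
  - by rewrite Fq.
  - move=> t t01 z' zb k; have [vH _] := rU _ zb.
    apply: le_trans (chart_speed_bound (Fh j Wj) zb.1 c0 (fun v => (vH v).1) (FK j z' Wj _) k) _.
      rewrite /z' addrC addKr normcM normc_real; apply: le_lt_trans zd.
      by rewrite ler_piMl ?normc_ge0 // ger0_norm; lra.
    by rewrite lerDl.
  - move: zr; rewrite ltr_pdivlMr ?mulr_gt0 // => zr.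
    by move: zr; set y := normc _; lra.
have qb' : chart_ball (X := X) i p r q.
  by split; [exact: qb.1|move=> k; apply: le_trans (qb.2 k) _; lra].
have [_ [_ qp]] := rU _ qb'; have [_ [pz _]] := rU _ big.
exact: entourage_split entE qp pz.
Qed.

(** A Lebesgue number argument along [g]: near each [z] a small entourage works, and compactness
    over the filter of small entourages selects one for all of [D]. *)
Lemma compact_entourage (T : topologicalType) (M : puniformType) (g : T -> M)
    (D : set T) (P : M -> M -> Prop) :
  compact D -> continuous g ->
  (forall z, D z -> exists2 U : set M, nbhs (g z) U &
     forall q q', U q -> U q' -> P q q') ->
  exists2 E, entourage E & forall z q, D z -> E (g z, q) -> P (g z) q.
Proof.
move=> cD gc DP.
have FF : Filter (powerset_filter_from (@entourage M)) by exact: _.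
have : \forall E \near powerset_filter_from (@entourage M),
    D `<=` (fun z => forall q, E (g z, q) -> P (g z) q).
  move: cD => /compact_near_coveringP/(_ _ _ _ FF); apply => z0 /DP[U gU UP].
  have /nbhsP[E1 entE1 E1U] := gU.
  have entE2 : entourage (split_ent E1) by exact: entourage_split_ent.
  have N1 : \forall z \near z0, split_ent E1 (g z0, g z).
    apply: (@filterS _ (nbhs z0) _ _ _ _ (gc z0 _ (nbhs_entourage (g z0) entE2))).
    by move=> z /xsectionP.
  have N2 : \forall z \near z0, U (g z) by exact: gc.
  exists ([set z | split_ent E1 (g z0, g z) /\ U (g z)],
          [set E' | E' `<=` split_ent E1]).
    split=> /=; first exact: filterI.
    exact: small_set_sub.
  move=> [z E'] /= [[h1 h2] h3] q /h3 h4; apply: UP => //.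
  by apply: E1U; apply/xsectionP; exact: entourage_split entE1 h1 h4.
move=> H; near (powerset_filter_from (@entourage M)) => E.
exists E; first by near: E; exact: near_small_set.
have HE : D `<=` (fun z => forall q, E (g z, q) -> P (g z) q) by near: E.
by move=> z q Dz; exact: HE.
Unshelve. all: by end_near. Qed.

Lemma holomorphic_closure (R : realType) n (M : puniformType)
    (X : complex_atlas R n M) (W : set (R[i] -> M)) (g : R[i] -> M) :
  (forall F, W F -> holomorphic_map X F) -> continuous g ->
  closure (W : set {family compact, R[i] -> M}) g -> holomorphic_map X g.
Proof.
move=> Wh gc gW; split=> // a i ia; apply: cdiff_at_differentiable => k.
have [r r0 rA] : exists2 r, 0 < r & forall z, normc (z - a) < r -> chart_dom X i (g z).
  apply/nbhs_complexP; apply: gc; apply: open_nbhs_nbhs; split=> //.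
  exact: chart_dom_open.
apply: (@cdiff_at_uniform_limit _ _ a (r / 2)); first by rewrite divr_gt0.
move=> e e0; pose D := [set z : R[i] | normc (z - a) <= r / 2].
have cD : compact D by exact: compact_disc.
(* A single entourage forces the approximant to stay in the chart domain over [D] and its coordinate
   to be [e]-close to that of [g]. *)
have [|E entE EP] := @compact_entourage _ _ g D (fun q q' => chart_dom X i q' /\
    normc (chart_map X i q ord0 k - chart_map X i q' ord0 k) <= e) cD gc.
  move=> z Dz; have iz : chart_dom X i (g z).
    by apply: rA; apply: le_lt_trans Dz _; lra.
  exists (chart_ball (X := X) i (g z) (e / 2)).
    by apply: nbhs_chart_ball => //; rewrite divr_gt0.
  move=> q q' [iq qb] [iq' qb']; split=> //.
  set x := chart_map X i q ord0 k; set y := chart_map X i q' ord0 k.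
  set w := chart_map X i (g z) ord0 k.
  have -> : x - y = (x - w) - (y - w) by ring.
  apply: le_trans (ler_normcB _ _) _; have := qb k; have := qb' k.
  by rewrite -/x -/y -/w; lra.
have [F [WF FE]] := gW _ (fam_nbhs (g : {family compact, R[i] -> M}) entE cD).
exists (fun z => chart_map X i (F z) ord0 k) => z za.
have Dz : D z by exact: ltW.
have [iz zE] := EP z (F z) Dz (FE z Dz).
split=> //; exists ('d (chart_map X i \o F) z (1 : R[i]) ord0 k).
by apply: (@differentiable_cdiff_at _ _ (chart_map X i \o F)); exact: (Wh F WF).2.
Qed.

(** Ascoli makes the full closure compact; it consists of holomorphic maps, so intersecting with
    them changes nothing. Limits are continuous because the closure agrees with the pointwise one,
    which is again equicontinuous. *)
Lemma equicontinuous_relatively_compact (R : realType) n (M : puniformType)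
    (X : complex_atlas R n M) (W : set (R[i] -> M)) :
  hausdorff_space M -> compact [set: M] ->
  (forall F, W F -> holomorphic_map X F) -> equicontinuous W id ->
  relatively_compact_holomorphic X W.
Proof.
move=> hM cM Wh We; rewrite /relatively_compact_holomorphic.
have pW : pointwise_precompact W id.
  move=> x; apply: (@precompact_subset _ _ [set: M]) => //.
  exact: compact_precompact.
have := @pointwise_precompact_equicontinuous _ _ hM _ pW We; rewrite precompactE.
set A := closure _ => cA; rewrite (_ : A `&` _ = A) //.
apply/seteqP; split=> [g []//|g Ag]; split=> //.
apply: (holomorphic_closure Wh _ Ag).
move: Ag; rewrite /A (pointwise_compact_closure We) => Ag.
exact: (equicontinuous_continuous (equicontinuous_closure We) Ag).
Qed.

(** * The Euclidean norm and the weight *)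

Lemma enormE (R : realType) m (z : 'rV[R[i]]_m) :
  enorm z = Num.sqrt (\sum_(k < m) normc (z ord0 k) ^+ 2).
Proof. by congr Num.sqrt; apply: eq_bigr => k _; rewrite normc_sqr. Qed.

Lemma enorm_ge0 (R : realType) m (z : 'rV[R[i]]_m) : 0 <= enorm z.
Proof. exact: sqrtr_ge0. Qed.

Lemma enorm_sqr (R : realType) m (z : 'rV[R[i]]_m) :
  enorm z ^+ 2 = \sum_(k < m) normc (z ord0 k) ^+ 2.
Proof. by rewrite enormE sqr_sqrtr // sumr_ge0 // => k _; exact: sqr_ge0. Qed.

Lemma enormZ (R : realType) m (c : R[i]) (z : 'rV[R[i]]_m) :
  enorm (c *: z) = normc c * enorm z.
Proof.
rewrite !enormE -[normc c]ger0_norm ?normc_ge0 // -sqrtr_sqr -sqrtrM ?sqr_ge0 //.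
by congr Num.sqrt; rewrite mulr_sumr; apply: eq_bigr => k _; rewrite mxE normcM exprMn.
Qed.

(** Sum [(b * x k - a * y k) ^+ 2 >= 0] and divide by [a * b]; if [a] or [b] is 0, all terms
    vanish. *)
Lemma cauchy_schwarz_sum (R : realType) (I : finType) (x y : I -> R) (a b : R) :
  0 <= a -> 0 <= b -> \sum_k x k ^+ 2 = a ^+ 2 -> \sum_k y k ^+ 2 = b ^+ 2 ->
  \sum_k x k * y k <= a * b.
Proof.
move=> a0 b0 xa yb.
have z0 (u : I -> R) : \sum_k u k ^+ 2 = 0 -> forall k, u k = 0.
  move=> /eqP; rewrite psumr_eq0; last by move=> k _; exact: sqr_ge0.
  by move=> /allP H k; have := H k (mem_index_enum k); rewrite sqrf_eq0 => /eqP.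
have [aE|aN] := eqVneq a 0.
  rewrite big1 ?mulr_ge0 // => k _; rewrite (z0 x) ?mul0r //.
  by rewrite xa aE expr0n.
have [bE|bN] := eqVneq b 0.
  rewrite big1 ?mulr_ge0 // => k _; rewrite (z0 y) ?mulr0 //.
  by rewrite yb bE expr0n.
have ab : 0 < a * b by rewrite mulr_gt0 // lt0r ?aN ?bN.
rewrite -(ler_pM2l ab) mulr_sumr.
apply: (@le_trans _ _ (\sum_k (b ^+ 2 * x k ^+ 2 + a ^+ 2 * y k ^+ 2) / 2)).
  apply: ler_sum => k _; have := sqr_ge0 (b * x k - a * y k).
  rewrite sqrrB !exprMn -mulr_natr; lra.
rewrite -mulr_suml big_split /= -!mulr_sumr xa yb.
by rewrite le_eqVlt; apply/orP; left; apply/eqP; field.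
Qed.

Lemma ler_enormD (R : realType) m (z w : 'rV[R[i]]_m) :
  enorm (z + w) <= enorm z + enorm w.
Proof.
rewrite -(@ler_pXn2r _ 2) ?nnegrE ?addr_ge0 ?enorm_ge0 // sqrrD !enorm_sqr.
have cs := cauchy_schwarz_sum (enorm_ge0 z) (enorm_ge0 w)
  (esym (enorm_sqr z)) (esym (enorm_sqr w)).
apply: le_trans (_ : \sum_(k < m) (normc (z ord0 k) ^+ 2 +
    normc (z ord0 k) * normc (w ord0 k) *+ 2 + normc (w ord0 k) ^+ 2) <= _).
  apply: ler_sum => k _; rewrite mxE -sqrrD lerXn2r ?nnegrE ?addr_ge0 ?normc_ge0 //.
  exact: ler_normcD.
by rewrite !big_split /= lerD2r lerD2l mulr2n lerD.
Qed.

Lemma enorm_perturb (R : realType) m (z xi : 'rV[R[i]]_m) (c : R[i]) :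
  enorm xi = 1 -> `|enorm (z + c *: xi) - enorm z| <= normc c.
Proof.
move=> xi1; have nc : enorm (c *: xi) = normc c by rewrite enormZ xi1 mulr1.
have h1 := ler_enormD z (c *: xi).
have h2 : enorm z <= enorm (z + c *: xi) + enorm (- c *: xi).
  by apply: le_trans (ler_enormD _ _); rewrite scaleNr addrK.
move: h2; rewrite enormZ xi1 mulr1 normc_opp ler_norml.
by move: h1; rewrite nc; lra.
Qed.

Lemma weight_slow (R : realType) (phi : R -> R) (e : R) :
  admissible_weight phi -> 0 < e ->
  exists2 r, 0 < r & forall a b, r <= a -> r <= b -> `|phi a - phi b| <= e * `|a - b|.
Proof.
move=> [_ _ lim] e0.
have near_lt : \forall r \near +oo, (weight_gamma phi r < e%:E)%E.
  apply: (lim [set x | (x < e%:E)%E]); apply: open_nbhs_nbhs; split.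
    exact: open_ereal_lt_ereal.
  by rewrite /= lte_fin.
have [r [r0 rE]] : exists r, 0 < r /\ (weight_gamma phi r < e%:E)%E.
  near (+oo : set_system R) => r; exists r; split; near: r => //.
  exact: nbhs_pinfty_gt.
have lip a b : r <= a -> a < b -> `|phi a - phi b| <= e * `|a - b|.
  move=> ra ab; have n0 : 0 < `|a - b| by rewrite normr_gt0 subr_eq0 lt_eqF.
  rewrite -ler_pdivrMr // -normf_div -lee_fin; apply: le_trans (ltW rE).
  by apply: ereal_sup_ubound; exists (a, b).
exists r => // a b ra rb; have [ab|ba|->] := ltgtP a b.
- exact: lip.
- by rewrite distrC [`|a - b|]distrC; exact: lip.
- by rewrite !subrr normr0 mulr0.
Unshelve. all: by end_near. Qed.

(** Far out, [phi] has Lipschitz constant [1 / (4 * rho)]. Hence [rho * phi s <= s / 2], so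
    [t >= s / 2] is large too, and then [|phi s - phi t| <= phi s / 4]. *)
Lemma weight_comparable (R : realType) (phi : R -> R) (rho r0 : R) :
  admissible_weight phi -> 0 < rho ->
  exists T, forall s t, T <= s -> `|t - s| <= phi s * rho ->
    r0 <= t /\ phi s <= 2 * phi t.
Proof.
move=> adm rho0; have e0 : 0 < (4 * rho)^-1 by rewrite invr_gt0 mulr_gt0.
have [r r_gt0 rH] := weight_slow adm e0.
have pr : 0 < phi r by apply: weight_gt0 => //; exact: ltW.
have ar := normr_ge0 r0; have prr := mulr_gt0 rho0 pr.
(* The first two terms give [s / 2 >= r] and [s / 2 >= r0]; the third absorbs [rho * phi r] into
   [s / 4]. *)
exists (2 * r + 2 * `|r0| + 4 * (rho * phi r)) => s t sT ts.
have rs : r <= s by lra.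
have ps : 0 < phi s by apply: weight_gt0 => //; lra.
have h1 : rho * phi s <= s / 2.
  have := rH s r rs (lexx r); rewrite ler_norml (@ger0_norm _ (s - r)); last by lra.
  move=> /andP[_ h]; have : rho * (phi s - phi r) <= rho * ((4 * rho)^-1 * (s - r)).
    by rewrite ler_pM2l.
  have -> : rho * ((4 * rho)^-1 * (s - r)) = (s - r) / 4 by field; exact: lt0r_neq0.
  lra.
have ht : s / 2 <= t by move: ts; rewrite ler_norml [phi s * _]mulrC; lra.
have r0t : r0 <= t by have := ler_norm r0; lra.
have rt : r <= t by lra.
split=> //; have := rH s t rs rt; rewrite [`|s - t|]distrC => h2.
have : (4 * rho)^-1 * `|t - s| <= (4 * rho)^-1 * (phi s * rho) by rewrite ler_pM2l.
have -> : (4 * rho)^-1 * (phi s * rho) = phi s / 4 by field; exact: lt0r_neq0.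
by move: h2; rewrite ler_norml; lra.
Qed.

Lemma cdiff_at_affine (R : realType) (a b z : R[i]) : cdiff_at (fun w => a + w * b) z b.
Proof.
move=> e e0; exists 1 => // w _.
have -> : a + w * b - (a + z * b) - b * (w - z) = 0 by ring.
by rewrite normc0 mulr_ge0 ?normc_ge0 // ltW.
Qed.

Lemma differentiable_line (R : realType) m (z xi : 'rV[R[i]]_m) (c zeta : R[i]) :
  differentiable (fun w : R[i] => z + (c * w) *: xi) zeta /\
  'd (fun w : R[i] => z + (c * w) *: xi) zeta (1 : R[i]) = c *: xi.
Proof.
have D k : cdiff_at (fun w => (z + (c * w) *: xi) ord0 k) zeta (c * xi ord0 k).
  apply: (cdiff_at_ext _ (cdiff_at_affine (z ord0 k) (c * xi ord0 k) zeta)) => w.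
  by rewrite !mxE; ring.
have df : differentiable (fun w : R[i] => z + (c * w) *: xi) zeta.
  by apply: cdiff_at_differentiable => k; exists (c * xi ord0 k).
split=> //; apply/rowP => k.
by rewrite (cdiff_at_unique (differentiable_cdiff_at k df) (D k)) mxE.
Qed.

Lemma holomorphic_line (R : realType) m n (M : topologicalType)
    (X : complex_atlas R n M) (f : 'rV[R[i]]_m -> M) (z xi : 'rV[R[i]]_m) (c : R[i]) :
  holomorphic_map X f ->
  holomorphic_map X (fun w : R[i] => f (z + (c * w) *: xi)).
Proof.
move=> [fc fd]; split=> [w|w i iw].
  apply: (@continuous_comp _ _ _ (fun w : R[i] => z + (c * w) *: xi) f); last exact: fc.
  by apply: differentiable_continuous; exact: (differentiable_line z xi c w).1.
apply: (@differentiable_comp _ _ _ _ (fun w : R[i] => z + (c * w) *: xi)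
  (chart_map X i \o f)); last exact: fd.
exact: (differentiable_line z xi c w).1.
Qed.

Lemma tangent_norm_line (R : realType) m n (M : topologicalType)
    (X : complex_atlas R n M) (H : hermitian_metric X) (f : 'rV[R[i]]_m -> M)
    (z xi : 'rV[R[i]]_m) (c w : R[i]) :
  holomorphic_map X f ->
  tangent_norm H (differential X (fun w : R[i] => f (z + (c * w) *: xi)) w (1 : R[i])) =
  normc c * tangent_norm H (differential X f (z + (c * w) *: xi) xi).
Proof.
move=> [fc fd]; pose g (w : R[i]) := z + (c * w) *: xi.
have [dg gE] := differentiable_line z xi c w.
have df := fd (g w) _ (chart_atP X (f (g w))).
have E : differential X (f \o g) w (1 : R[i]) = c *: differential X f (g w) xi.
  rewrite /differential; have := diff_comp dg df => /(congr1 (fun h => h (1 : R[i]))) /= E.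
  by rewrite -linearZ -gE -E.
rewrite -[LHS]/(tangent_norm H (differential X (f \o g) w (1 : R[i]))) E.
rewrite /tangent_norm hformZ ReM_real sqrtrM ?sqr_ge0 // sqrtr_sqr.
by rewrite ger0_norm ?normc_ge0.
Qed.

(** * Yosida mappings and normal families *)

Lemma limf_esup_yosida_lty (R : realType) m
    (g : 'rV[R[i]]_m * 'rV[R[i]]_m -> R) :
  (limf_esup (fun q => (g q)%:E) (@yosida_filter R m) < +oo)%E <->
  exists r K, forall z xi, r < enorm z -> enorm xi = 1 -> g (z, xi) <= K.
Proof.
split=> [/ereal_inf_lt[_ [A [r _ rA] <-]] supA|[r [K gK]]].
  pose s := ereal_sup ((fun q => (g q)%:E) @` A).
  have gs z xi : r < enorm z -> enorm xi = 1 -> ((g (z, xi))%:E <= s)%E.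
    by move=> rz xi1; apply: ereal_sup_ubound; exists (z, xi) => //; exact: rA.
  exists r; move: supA gs; rewrite -/s; case: s => [K| |] // _ gs.
    by exists K => z xi rz xi1; have := gs z xi rz xi1; rewrite lee_fin.
  (* A supremum [-oo] leaves no admissible pair, so the bound is vacuous. *)
  by exists 0 => z xi rz xi1; have := gs z xi rz xi1.
pose A := [set q : 'rV[R[i]]_m * 'rV[R[i]]_m | r < enorm q.1 /\ enorm q.2 = 1].
apply: (@le_lt_trans _ _ (ereal_sup ((fun q => (g q)%:E) @` A))).
  by apply: ereal_inf_lbound; exists A => //; exists r.
apply: (@le_lt_trans _ _ K%:E); last exact: ltry.
by apply: ge_ereal_sup => _ [[z xi] [/= rz xi1] <-]; rewrite lee_fin; exact: gK.
Qed.

Lemma yosida_normal_family (R : realType) (m n : nat) (M : puniformType)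
    (X : complex_atlas R n M) (H : hermitian_metric X) (phi : R -> R)
    (f : 'rV[R[i]]_m -> M) (z xi : nat -> 'rV[R[i]]_m) (r0 K : R) :
  hausdorff_space M -> compact [set: M] -> admissible_weight phi ->
  holomorphic_map X f ->
  (forall z xi, r0 < enorm z -> enorm xi = 1 ->
     phi (enorm z) * tangent_norm H (differential X f z xi) <= K) ->
  enorm (z j) @[j --> \oo] --> +oo -> (forall j, enorm (xi j) = 1) ->
  normal_family X (range (fun (j : nat) (zeta : R[i]) =>
    f (z j + ((phi (enorm (z j)))%:C * zeta) *: xi j))).
Proof.
move=> hM cM adm fh fK zoo xi1.
set F := fun (j : nat) (zeta : R[i]) => _.
have Fh j : holomorphic_map X (F j) by exact: holomorphic_line.
have Feq : equicontinuous (range F) id.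
  move=> a E entE; pose rho := normc a + 1.
  have rho0 : 0 < rho by rewrite ltr_wpDl // normc_ge0.
  (* [rho] bounds [|w|] on the unit disc about [a]; [r0 + 1] turns the weak inequality obtained into
     the strict one that the Yosida bound requires. *)
  have [T TH] := weight_comparable (r0 + 1) adm rho0.
  have [J _ JH] : \forall j \near \oo, Num.max T 0 <= enorm (z j).
    by move/cvgryPge : zoo; exact.
  have tail : \forall w \near a, forall j, [set j | (J <= j)%N] j -> E (F j a, F j w).
    apply: (@equicontinuous_bounded_speed _ _ _ _ H _ _ F a 1 (2 * K)) => // j w /= Jj wa.
    rewrite /F tangent_norm_line // normc_real.
    set s := enorm (z j); set c := (_ * w); set t := enorm (z j + c *: xi j).
    have := JH j Jj; rewrite ge_max => /andP[Ts s0].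
    have ps : 0 < phi s by exact: weight_gt0.
    have [|rt pst] := TH s t Ts.
      apply: le_trans (enorm_perturb _ _ (xi1 j)) _.
      rewrite /c normcM normc_real ger0_norm ?(ltW ps) // ler_wpM2l ?(ltW ps) //.
      have -> : w = (w - a) + a by rewrite subrK.
      by apply: le_trans (ler_normcD _ _) _; rewrite /rho; lra.
    rewrite ger0_norm ?(ltW ps) //.
    have := fK (z j + c *: xi j) (xi j); rewrite -/t => /(_ _ (xi1 j)) h.
    have {}h := h ltac:(lra); set tn := tangent_norm _ _ in h *.
    have tn0 : 0 <= tn by exact: sqrtr_ge0.
    apply: (@le_trans _ _ (2 * phi t * tn)); first by rewrite ler_wpM2r.
    by rewrite -mulrA ler_pM2l.
  (* The finitely many remaining maps are merely continuous, which is enough for a finite set. *)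
  have head : \forall w \near a, forall j : 'I_J, E (F j a, F j w).
    apply: (@filter_forall _ _ _ _ (nbhs_filter a)) => j.
    apply: (@filterS _ (nbhs a) _ _ _ _ ((Fh j).1 a _ (nbhs_entourage (F j a) entE))).
    by move=> w /xsectionP.
  apply: filterS2 head tail => w h1 h2 _ [j _ <-] /=.
  have [jJ|Jj] := ltnP j J; first exact: (h1 (Ordinal jJ)).
  exact: h2.
split; first by move=> _ [j _ <-]; exact: Fh.
(* Equicontinuity passes to the range of any sequence in the family, so the sequence itself serves
   as the subsequence. *)
move=> u uF; exists id => //.
apply: equicontinuous_relatively_compact => //.
  by move=> _ [k _ <-] /=; have [j _ <-] := uF k; exact: Fh.
by apply: equicontinuous_subset_id Feq => _ [k _ <-]; exact: uF.
Qed.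

(** A cluster point controls maps of arbitrarily large index, not all of them; [K] depends on the
    cluster point and its chart and is fixed before [N]. *)
Lemma normal_family_bounded_speed (R : realType) (n : nat) (M : puniformType)
    (X : complex_atlas R n M) (H : hermitian_metric X) (F : nat -> R[i] -> M) :
  (forall j, holomorphic_map X (F j)) ->
  relatively_compact_holomorphic X (range F) ->
  exists K, forall N, exists2 k, (N <= k)%N &
    tangent_norm H (differential X (F k) 0 (1 : R[i])) <= K.
Proof.
move=> Fh; rewrite /relatively_compact_holomorphic; set A := range F => cK.
have [g [[_ [gc gd]] gcl]] : exists g : {family compact, R[i] -> M},
    (closure (A : set {family compact, R[i] -> M}) `&` [set g | holomorphic_map X g]) g /\
    cluster ((F : nat -> {family compact, R[i] -> M}) @ \oo) g.
  have FK : ((F : nat -> {family compact, R[i] -> M}) @ \oo)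
      (closure (A : set {family compact, R[i] -> M}) `&` [set g | holomorphic_map X g]).
    exists 0%N => // k _; split; last exact: Fh.
    by apply: subset_closure; exists k.
  by have [g ?] := cK _ _ FK; exists g.
have i0 := chart_atP X (g 0); set i := chart_at X (g 0) in i0.
have [c [C [c0 C0 pC]]] := chart_metric_bounds H i0.
have [r r_gt0 [rC bi]] := chart_ball_sub i0 pC.
(* The ball has to be a neighbourhood of each [g w], so that maps close to [g] also take values in
   it. *)
have [d d0 dH] : exists2 d, 0 < d & forall w, normc (w - 0) < d ->
    nbhs (g w) (chart_ball (X := X) i (g 0) r).
  apply/nbhs_complexP; apply: (gc 0 [set q | nbhs q (chart_ball (X := X) i (g 0) r)]).
  by apply: nbhs_interior; exact: nbhs_chart_ball.
pose D := [set w : R[i] | normc (w - 0) <= d / 2].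
have cD : compact D by exact: compact_disc.
have [|E entE EP] := @compact_entourage _ _ g D
    (fun q q' => chart_ball (X := X) i (g 0) r q') cD gc.
  move=> w Dw; exists (chart_ball (X := X) i (g 0) r) => //.
  by apply: dH; apply: le_lt_trans Dw _; lra.
pose x := chart_map X i (g 0).
pose B := \sum_k normc (x ord0 k) + r.
have xB k : normc (x ord0 k) + r <= B.
  by rewrite lerD2r (bigD1 k) //= lerDl sumr_ge0 // => l _; exact: normc_ge0.
(* The disc of radius [2 * L] is [D]. Coordinates are at most [B] there, so their derivatives at 0
   are at most [4 * B / L], and [C] converts this into a Hermitian length. *)
pose L := d / 4; have L0 : 0 < L by rewrite divr_gt0.
exists (Num.sqrt (C * (4 * B / L) ^+ 2)) => N.
have [h [[k Nk <-] hE]] : (F @` [set k | (N <= k)%N]) `&`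
    [set h : {family compact, R[i] -> M} | forall w, D w -> E (g w, h w)] !=set0.
  apply: gcl; last exact: fam_nbhs.
  by exists N => // k Nk; exists k.
exists k => //.
have ball w : D w -> chart_ball (X := X) i (g 0) r (F k w).
  by move=> Dw; apply: (EP w (F k w) Dw); exact: hE.
have D0 : D 0.
  suff : normc ((0 : R[i]) - 0) <= d / 2 by [].
  by rewrite subrr normc0 divr_ge0 // ltW.
rewrite (tangent_norm_differential H _ (Fh k) (ball 0 D0).1).
apply: ler_wsqrtr; have vH := rC _ (ball 0 D0).
apply: (proj2 (vH _)) => l; rewrite ler_pdivlMr //.
apply: (@cauchy_estimate _ (fun w => chart_map X i (F k w) ord0 l) 0) => //.
  move=> w; rewrite /L => wd.
  have Dw : D w by apply: le_trans wd _; lra.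
  have [iw bw] := ball w Dw; split.
    exists ('d (chart_map X i \o F k) w (1 : R[i]) ord0 l).
    by apply: (@differentiable_cdiff_at _ _ (chart_map X i \o F k)); exact: (Fh k).2.
  apply: le_trans (xB l); rewrite -[chart_map _ _ _ _ _](subrK (x ord0 l)) addrC.
  apply: le_trans (ler_normcD _ _) _; rewrite lerD2l; exact: bw.
by apply: (@differentiable_cdiff_at _ _ (chart_map X i \o F k)); exact: (Fh k).2 (ball 0 D0).1.
Qed.

Theorem proposition2p2 (R : realType) (m n : nat) (hm : (1 <= m)%N)
    (M : puniformType) (M_hausdorff : hausdorff_space M)
    (M_compact : compact [set: M])
    (X : complex_atlas R n M) (H : hermitian_metric X)
    (phi : R -> R) (phi_adm : admissible_weight phi)
    (f : 'rV[R[i]]_m -> M) (f_holo : holomorphic_map X f) :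
  weighted_yosida H phi f <->
  (forall z xi : nat -> 'rV[R[i]]_m,
     enorm (z j) @[j --> \oo] --> +oo ->
     (forall j, enorm (xi j) = 1) ->
     normal_family X
       (range (fun (j : nat) (zeta : R[i]) =>
          f (z j + ((phi (enorm (z j)))%:C * zeta) *: xi j)))).
Proof.
split=> [[_ /limf_esup_yosida_lty[r [K fK]]] z xi zoo xi1|normal].
  exact: (yosida_normal_family M_hausdorff M_compact phi_adm f_holo fK).
split=> //; apply/limf_esup_yosida_lty; apply: contrapT => unbounded.
(* The index [j] serves both as radius and as bound, so the points go to infinity and the blow-up
   persists along every subsequence. *)
have bad (j : nat) : exists q : 'rV[R[i]]_m * 'rV[R[i]]_m,
    [/\ j%:R < enorm q.1, enorm q.2 = 1 &
     j%:R < phi (enorm q.1) * tangent_norm H (differential X f q.1 q.2)].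
  apply: contrapT => nq; apply: unbounded; exists j%:R, j%:R => z xi zj xi1 /=.
  by rewrite leNgt; apply/negP => h; apply: nq; exists (z, xi).
have [q Hq] := choice bad.
have zoo : enorm (q j).1 @[j --> \oo] --> +oo.
  apply/cvgryPge => a; near=> j; have [h _ _] := Hq j.
  by apply: le_trans (ltW h); near: j; exact: nbhs_infty_ger.
have [_ /(_ _ (fun j => ex_intro2 _ _ j I erefl))[s s_homo rel]] :=
  normal (fun j => (q j).1) (fun j => (q j).2) zoo (fun j => let: And3 _ h _ := Hq j in h).
have [|K HK] := @normal_family_bounded_speed _ _ _ _ H _ _ rel.
  by move=> j; exact: holomorphic_line.
have [N KN] : exists N : nat, K < N%:R.
  by exists (Num.truncn K).+1; apply: truncnS_gt.
have [k Nk] := HK N; apply/negP; rewrite -ltNge.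
(* A strictly increasing [s] satisfies [k <= s k], so the speed at 0 exceeds [s k >= k >= N > K]. *)
have sk : (k <= s k)%N.
  elim: (k) => [//|k' IH]; exact: leq_ltn_trans IH (s_homo _ _ (ltnSn _)).
rewrite /= tangent_norm_line // mulr0 scale0r addr0 normc_real.
have [h1 h2 h3] := Hq (s k).
rewrite ger0_norm; last by apply/ltW/(weight_gt0 phi_adm); exact: enorm_ge0.
apply: lt_trans KN _; apply: le_lt_trans h3; rewrite ler_nat.
exact: leq_trans Nk sk.
Unshelve. all: by end_near. Qed.
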